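(* Let $\Omega \subset \mathbb{C}^n$ be a bounded domain with $C^0$-boundary, with associated balls $B(x_j,r_j)$ and unit vectors $w_j$ as in the definition of $C^0$-boundary. Assume that there exist a function $f:\mathbb{R}^+\to\mathbb{R}$ and constants $c\ge 1$ and $\epsilon_1<1$ such that $$\delta(z,\partial\Omega)+f(\epsilon)\le \delta(z+\epsilon w_j,\partial\Omega)$$ whenever $z\in\Omega\cap B(x_j,r_j/c)$ for some $j$ and $0<\epsilon<\epsilon_1$. Then there exist a constant $0<\epsilon_0\le\epsilon_1$, depending on $\Omega$, $c$ and $\epsilon_1$, and a constant $C>1$, depending on $\operatorname{diam}(\Omega)$, $\Omega$ and $c$, such that the following holds. If $\phi\in\mathcal{PSH}(\overline{\Omega})\cap C(\overline{\Omega})$ and $0<\epsilon<\epsilon_0$ are given, then there exist a domain $U_\psi\Supset\Omega$ and a function $\psi\in\mathcal{PSH}(U_\psi)\cap C(U_\psi)$ such that $$|\psi(z)-\phi(z)|\le C\,\omega(\epsilon)\quad\text{for all } z\in\overline{\Omega},$$ where $\omega:\mathbb{R}^+\to\mathbb{R}^+$ is the modulus of continuity of $\phi$ on $\overline{\Omega}$, and moreover $$f(\epsilon)<\delta(\Omega,\partial U_\psi).$$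
   Context: A domain is a connected open set. $\mathbb{C}^n$ is identified with $\mathbb{R}^{2n}$, $B(x,r)$ is the open Euclidean ball, $\delta(E,F)$ is the Euclidean distance between sets (with $\delta(y,F)=\delta(\{y\},F)$), and $\operatorname{diam}$ is the diameter. $U\Supset\Omega$ means that $\overline{\Omega}$ is a compact subset of $U$. A bounded open set $\Omega\subset\mathbb{R}^m$ has $C^0$-boundary if there exists a finite set of balls $\{B(x_j,r_j)\}$, with $x_j\in\partial\Omega$ and $r_j>0$, that covers an open neighbourhood of $\partial\Omega$ and such that, for each $j$, in an appropriate (Euclidean) coordinate system $y=(y',y_m)$, $$\Omega\cap B(x_j,4r_j)=\{y: y_m>\phi_j(y')\}\cap B(x_j,4r_j),\qquad \partial\Omega\cap B(x_j,4r_j)=\{y: y_m=\phi_j(y')\}\cap B(x_j,4r_j),$$ where $\phi_j:\mathbb{R}^{m-1}\to\mathbb{R}$ is continuous. For $\Omega\subset\mathbb{C}^n$ (so $m=2n$), $w_j\in\partial B(0,1)$ denotes the unit vector of $\mathbb{C}^n$ which is the basis vector $e_{2n}$ in the local coordinates associated with $B(x_j,r_j)$, i.e. the local direction given by the graph. $\mathcal{PSH}(U)$ is the class of plurisubharmonic functions on $U$, and $\mathcal{PSH}(\overline{\Omega})$ is the class of functions plurisubharmonic on some neighbourhood of $\overline{\Omega}$. The modulus of continuity of $\phi$ on $\overline{\Omega}$ is $\omega(t)=\sup\{|\phi(z)-\phi(\zeta)| : z,\zeta\in\overline{\Omega},\ |z-\zeta|\le t\}$.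
   Formalization: Added assumption: the shrunken balls B(x_j, r_j/c) still cover a neighbourhood of ∂Ω (automatic for c=1); without it f is unconstrained on part of ∂Ω and the claim fails for n≥2. Also ε_1>0 is made explicit. *)

(* Defs.v *)
From HB Require Import structures.
From mathcomp Require Import all_boot all_order all_algebra.
From mathcomp Require Import all_classical all_reals all_analysis.
From mathcomp Require Import complex.

Set Implicit Arguments.
Unset Strict Implicit.
Unset Printing Implicit Defensive.

Import Order.TTheory GRing.Theory Num.Theory.
Import numFieldNormedType.Exports.

Local Open Scope classical_set_scope.
Local Open Scope ring_scope.

(* The topology and [bounded_set] come from the library structure on
   ['rV[R]_m], whose norm [`|x|] is the sup norm; they agree with the Euclidean
   ones.  Metric quantities use the Euclidean norm below. *)
Definition enorm (R : realType) (m : nat) (x : 'rV[R]_m) : R :=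
  Num.sqrt (\sum_(i < m) x 0 i ^+ 2).

Definition eball (R : realType) (m : nat) (x : 'rV[R]_m) (r : R) :
  set 'rV[R]_m := [set y | enorm (y - x) < r].

(* Extended real valued, so that a distance to the empty set is [+oo]. *)
Definition set_dist (R : realType) (m : nat) (E F : set 'rV[R]_m) : \bar R :=
  ereal_inf [set d | exists x y, [/\ E x, F y & d = (enorm (x - y))%:E]].

Definition boundary (T : topologicalType) (A : set T) : set T :=
  closure A `\` interior A.

Definition domain (T : topologicalType) (A : set T) : Prop :=
  open A /\ connected A.

Definition compactly_contained (T : topologicalType) (A U : set T) : Prop :=
  compact (closure A) /\ closure A `<=` U.

(* The rows of [V] followed by [w] form an orthonormal basis of R^m. *)
Definition orthonormal_frame (R : realType) (m : nat)
    (V : 'M[R]_(m.-1, m)) (w : 'rV[R]_m) : Prop :=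
  [/\ V *m V^T = 1%:M, V *m w^T = 0 & w *m w^T = 1%:M].

(* The coordinates (y', y_m) of [z] with origin [o] and basis [V], [w]; thus
   [w] is the direction of the last coordinate axis. *)
Definition coord' (R : realType) (m : nat) (o : 'rV[R]_m)
    (V : 'M[R]_(m.-1, m)) (z : 'rV[R]_m) : 'rV[R]_m.-1 := (z - o) *m V^T.

Definition coord_last (R : realType) (m : nat) (o w z : 'rV[R]_m) : R :=
  ((z - o) *m w^T) 0 0.

Definition covers_neighbourhood (R : realType) (m k : nat) (A : set 'rV[R]_m)
    (x : 'I_k -> 'rV[R]_m) (r : 'I_k -> R) : Prop :=
  exists N : set 'rV[R]_m,
    [/\ open N, A `<=` N & N `<=` [set z | exists j, eball (x j) (r j) z]].

Definition C0_boundary (R : realType) (m k : nat) (Omega : set 'rV[R]_m)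
    (x : 'I_k -> 'rV[R]_m) (r : 'I_k -> R) (w : 'I_k -> 'rV[R]_m) : Prop :=
  [/\ forall j, boundary Omega (x j) /\ 0 < r j,
      covers_neighbourhood (boundary Omega) x r &
      forall j, exists (o : 'rV[R]_m) (V : 'M[R]_(m.-1, m))
                       (g : 'rV[R]_m.-1 -> R),
        [/\ orthonormal_frame V (w j), continuous g,
            Omega `&` eball (x j) (4 * r j) =
              [set z | g (coord' o V z) < coord_last o (w j) z]
                `&` eball (x j) (4 * r j) &
            boundary Omega `&` eball (x j) (4 * r j) =
              [set z | coord_last o (w j) z = g (coord' o V z)]
                `&` eball (x j) (4 * r j)]].

(* The identification of C^n with R^(2n). *)
Definition realify (R : realType) (n : nat) (z : 'rV[R[i]]_n) :
    'rV[R]_(n + n) :=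
  row_mx (map_mx (@complex.Re R) z) (map_mx (@complex.Im R) z).

Definition upper_semicontinuous_on (T : topologicalType) (R : realType)
    (U : set T) (u : T -> \bar R) : Prop :=
  forall z (a : R), U z -> (u z < a%:E)%E ->
    \forall y \near z, U y -> (u y < a%:E)%E.

(* Plurisubharmonic functions are valued in [-oo, +oo), and the value [-oo]
   is allowed identically.  The mean value inequality is required on every
   closed disc {a + tau b : |tau| <= 1} contained in [U] and lying in a complex
   line; its integrand is bounded above, hence the integral, possibly [-oo],
   is the usual one. *)
Definition plurisubharmonic (R : realType) (n : nat) (U : set 'rV[R]_(n + n))
    (u : 'rV[R]_(n + n) -> \bar R) : Prop :=
  [/\ open U,
      forall z, U z -> (u z < +oo)%E,
      upper_semicontinuous_on U u &
      forall a b : 'rV[R[i]]_n,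
        (forall tau : R[i], `|tau| <= 1 -> U (realify (a + tau *: b))) ->
        (u (realify a) <=
          ((2 * pi)^-1)%:E *
          \int[@lebesgue_measure R]_(t in `[0%R, (2 * pi)%R])
             u (realify (a + (cos t +i* sin t)%C *: b)))%E].

Definition psh_near (R : realType) (n : nat) (A : set 'rV[R]_(n + n))
    (u : 'rV[R]_(n + n) -> \bar R) : Prop :=
  exists V : set 'rV[R]_(n + n), A `<=` V /\ plurisubharmonic V u.

(* [u] restricts to a real-valued continuous function on [A]. *)
Definition continuous_on (T : topologicalType) (R : realType) (A : set T)
    (u : T -> \bar R) : Prop :=
  (forall z, A z -> u z \is a fin_num) /\ {within A, continuous u}.

Definition modulus (R : realType) (m : nat) (u : 'rV[R]_m -> \bar R)
    (A : set 'rV[R]_m) (t : R) : \bar R :=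
  ereal_sup [set d | exists z zeta, [/\ A z, A zeta, enorm (z - zeta) <= t &
                                        d = `|u z - u zeta|%E]].

(* Main.v *)
(* Since [w j] points into [Omega], the translate [phi (z + 2 eps (w j))] is
   defined near the part of the boundary lying in the [j]-th ball.  Translating
   by [2 eps] rather than [eps] matters: for a boundary point [p] the hypothesis
   applied to [z = p + eps (w j)] gives
   [f eps < dist (p + 2 eps (w j), boundary)], and compactness turns the strict
   inequality into room for a neighbourhood of [Omega] of radius [mu > f eps] all
   of whose translates stay in [Omega].  Hence [phi], continuous only on the
   closure of [Omega], need not be regularized.

   To each translate one adds a large multiple [A] of
   [s_j^2 - tau - |z - x_j|^2 + |z|^2], which is an affine function of [z], and to
   [phi] itself one adds [A (tau + |z|^2)].  The maximum [psi] of the functions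
   active at a point is continuous because a function about to leave its domain is
   dominated by another one, the oscillations being at most [8 omega(eps)].

   The local mean value inequality for [psi] is inherited from the active function
   that attains the maximum.  It extends to large discs by averaging over the
   rotations by roots of unity and the maximum principle. *)

Require Import Defs.
From mathcomp Require Import all_boot all_order all_algebra.
From mathcomp Require Import all_classical all_reals all_analysis.
From mathcomp Require Import complex ring lra.
Import Order.TTheory GRing.Theory Num.Theory.
Import numFieldNormedType.Exports.
Local Open Scope classical_set_scope.
Local Open Scope ring_scope.

Set Implicit Arguments.
Unset Strict Implicit.
Unset Printing Implicit Defensive.

(** * Circle means *)

Section CircleMean.
Variable R : realType.
Implicit Types h : R -> R.
Local Notation mu := (@lebesgue_measure R).

Definition cmean h : R := (2 * pi)^-1 * \int[mu]_(t in `[0%R, (2 * pi)%R]) h t.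

Lemma twopi_gt0 : 0 < 2 * pi :> R.
Proof. by rewrite mulr_gt0 ?pi_gt0. Qed.

Lemma continuous_integrable_itv h (a b : R) :
  continuous h -> mu.-integrable `[a, b] (EFin \o h).
Proof.
move=> ch; apply: continuous_compact_integrable; first exact: segment_compact.
exact: continuous_subspaceT.
Qed.

Lemma cmeanD h1 h2 : continuous h1 -> continuous h2 ->
  cmean (fun t => h1 t + h2 t) = cmean h1 + cmean h2.
Proof.
move=> c1 c2; rewrite /cmean RintegralD ?mulrDr //; exact: continuous_integrable_itv.
Qed.

Lemma cmeanZ h (l : R) : continuous h ->
  cmean (fun t => l * h t) = l * cmean h.
Proof.
move=> ch; rewrite /cmean RintegralZl//; last exact: continuous_integrable_itv.
by rewrite mulrCA.
Qed.

Lemma cmean_cst (l : R) : cmean (fun=> l) = l.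
Proof.
rewrite /cmean Rintegral_cst//= lebesgue_measure_itv /= lte_fin twopi_gt0.
by rewrite -EFinB /= subr0 mulrC mulfK// gt_eqF// twopi_gt0.
Qed.

Lemma le_cmean h1 h2 : continuous h1 -> continuous h2 ->
  (forall t, h1 t <= h2 t) -> cmean h1 <= cmean h2.
Proof.
move=> c1 c2 h12; rewrite /cmean ler_pM2l ?invr_gt0 ?twopi_gt0//.
by apply: le_Rintegral => //; exact: continuous_integrable_itv.
Qed.

Lemma cmean_sum (I : finType) (h : I -> R -> R) :
  (forall i, continuous (h i)) ->
  cmean (fun t => \sum_i h i t) = \sum_i cmean (h i).
Proof.
move=> ch.
suff [_ ->] : continuous (fun t => \sum_i h i t) /\
  cmean (fun t => \sum_i h i t) = \sum_i cmean (h i) by [].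
elim: (index_enum I) => [|i s [cs IH]].
  split; first by move=> t; under eq_fun do rewrite big_nil; exact: cvg_cst.
  by under eq_fun do rewrite big_nil; rewrite big_nil cmean_cst.
have E : (fun t => \sum_(j <- i :: s) h j t)
    = (fun t => h i t + \sum_(j <- s) h j t).
  by apply/funext => t; rewrite big_cons.
rewrite E big_cons cmeanD//; split; last by rewrite IH.
by move=> t; apply: cvgD; [exact: ch|exact: cs].
Qed.

(** The mean value theorem for the antiderivative [I] on each of [N] equal arcs makes the mean an
    exact Riemann sum, at sample points not under control. *)
Lemma cmean_mvt h (N : nat) : (0 < N)%N -> continuous h ->
  exists2 xi : nat -> R,
    (forall k, (k < N)%N ->
       k%:R * (2 * pi / N%:R) <= xi k <= k.+1%:R * (2 * pi / N%:R)) &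
    cmean h = N%:R^-1 * \sum_(k < N) h (xi k).
Proof.
move=> N0 ch; set d := 2 * pi / N%:R.
have NR : 0 < N%:R :> R by rewrite ltr0n.
have d0 : 0 < d by rewrite divr_gt0// twopi_gt0.
have dN : N%:R * d = 2 * pi by rewrite /d mulrC divfK// gt_eqF.
pose I (x : R) := \int[mu]_(t in [set` `[0, x]]) h t.
have cI : {within `[0%R, (2 * pi)%R], continuous I}.
  apply: parameterized_integral_continuous; first exact/ltW/twopi_gt0.
  exact: continuous_integrable_itv.
have dI (x : R) : 0 < x -> is_derive x 1 I (h x).
  move=> x0.
  (* The interval is enlarged to [[0, x + 1]] so that [x] is interior to it. *)
  have x1 : x < x + 1 by rewrite ltrDl.
  have [dIx Ix] := continuous_FTC1_closed x1
    (@continuous_integrable_itv h 0 (x + 1) ch) x0 (ch x).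
  by apply: DeriveDef => //; rewrite -derive1E.
have step k : exists x : R, (k < N)%N ->
    (k%:R * d <= x <= k.+1%:R * d) /\ I (k.+1%:R * d) - I (k%:R * d) = h x * d.
  have [kN|] := ltnP k N; last by exists 0.
  have [|||x xi e] := @MVT_segment R I h (k%:R * d) (k.+1%:R * d).
  - by rewrite ler_pM2r// ler_nat.
  - move=> x; rewrite in_itv/= => /andP[kx _]; apply: dI.
    by apply: le_lt_trans kx; rewrite mulr_ge0// ltW.
  - apply: continuous_subspaceW cI; apply: subset_itvScc; rewrite bnd_simp.
      by rewrite mulr_ge0// ltW.
    by rewrite -dN ler_pM2r// ler_nat.
  exists x => _; split; first by move: xi; rewrite in_itv.
  by rewrite e -mulrBl -natrB// subSnn mul1r.
have [xi xiP] := @choice _ _ _ step.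
exists xi => [k kN|]; first by have [] := xiP k kN.
have I0 : I 0 = 0 by rewrite /I set_itv1 Rintegral_set1.
have -> : cmean h = (2 * pi)^-1 * (I (N%:R * d) - I (0%:R * d)).
  by rewrite dN mul0r I0 subr0.
rewrite -(telescope_sumr (fun k => I (k%:R * d)))// big_mkord.
under eq_bigr => k _ do rewrite (xiP k (ltn_ord k)).2.
rewrite -mulr_suml mulrCA mulrC; congr (_ * _).
by rewrite -dN invfM -mulrA mulVf ?mulr1 // gt_eqF.
Qed.

Lemma cmean_cos : cmean (@cos R) = 0.
Proof.
rewrite /cmean /Rintegral (@continuous_FTC2 _ _ (@sin R)) ?twopi_gt0 //=.
- by rewrite sin0 mulr_natl sin2pi subr0 /= mulr0.
- exact/continuous_subspaceT/continuous_cos.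
- split; [by move=> x _; exact: ex_derive| |].
    by apply: cvg_at_right_filter; exact: continuous_sin.
  by apply: cvg_at_left_filter; exact: continuous_sin.
- by move=> x _; rewrite derive1E derive_val.
Qed.

Lemma cmean_sin : cmean (@sin R) = 0.
Proof.
rewrite /cmean /Rintegral (@continuous_FTC2 _ _ (fun t => - cos t)) ?twopi_gt0 //=.
- by rewrite cos0 mulr_natl cos2pi opprK addNr /= mulr0.
- exact/continuous_subspaceT/continuous_sin.
- split; [by move=> x _; exact: ex_derive| |].
    by apply: cvg_at_right_filter; apply: cvgN; exact: continuous_cos.
  by apply: cvg_at_left_filter; apply: cvgN; exact: continuous_cos.
- by move=> x _; rewrite derive1E derive_val opprK.
Qed.

End CircleMean.

(** * From small discs to large discs *)

Section LocalToGlobal.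
Variable R : realType.
Local Notation Re := (@complex.Re R).
Local Notation Im := (@complex.Im R).
Local Open Scope complex_scope.

Definition eit (t : R) : R[i] := cos t +i* sin t.

(** Squared modulus with values in [R], since the norm of [R[i]] takes values in [R[i]]. *)
Definition sqn (z : R[i]) : R := Re z ^+ 2 + Im z ^+ 2.

Lemma sqnM z1 z2 : sqn (z1 * z2) = sqn z1 * sqn z2.
Proof. by case: z1 => a b; case: z2 => c d; rewrite /sqn /=; ring. Qed.

Lemma sqn_eit t : sqn (eit t) = 1.
Proof. exact: cos2Dsin2. Qed.

(** The cross term is twice a sum of two products of coordinates, each at most [s]. *)
Lemma sqnD_le z1 z2 (s : R) : sqn z1 <= 1 -> sqn z2 <= s ^+ 2 -> 0 <= s ->
  sqn (z1 + z2) <= sqn z1 + s ^+ 2 + 4 * s.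
Proof.
case: z1 => a b; case: z2 => c d; rewrite /sqn /= => ab cd s0.
have sq (x y l : R) : 0 <= l -> x ^+ 2 + y ^+ 2 <= l ^+ 2 -> `|x| <= l.
  move=> l0 xy; rewrite -(ler_pXn2r (n := 2)) ?nnegrE// real_normK ?num_real//.
  by rewrite (le_trans _ xy)// lerDl sqr_ge0.
have mul (x y : R) : `|x| <= 1 -> `|y| <= s -> x * y <= s.
  move=> x1 ys; rewrite (le_trans (ler_norm _))// normrM -[s]mul1r.
  by rewrite ler_pM.
have ab1 : a ^+ 2 + b ^+ 2 <= 1 ^+ 2 by rewrite expr1n.
have ac := mul a c (sq _ _ _ ler01 ab1) (sq _ _ _ s0 cd).
rewrite addrC in ab1; rewrite addrC in cd.
have bd := mul b d (sq _ _ _ ler01 ab1) (sq _ _ _ s0 cd).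
by rewrite !sqrrD; lra.
Qed.

Lemma eitD s t : eit (s + t) = eit s * eit t.
Proof. by rewrite /eit cosD sinD; simpc; rewrite (addrC (sin s * _)). Qed.

Lemma eit_2pi : eit (2 * pi) = 1.
Proof. by rewrite /eit mulr_natl cos2pi sin2pi. Qed.

Lemma sqn_le1E (z : R[i]) : (`|z| <= 1) = (sqn z <= 1).
Proof.
by rewrite normc_def -[1]/(1%:C) lecR -[X in _ <= X]sqrtr1 ler_sqrt.
Qed.

Lemma sqn1_eit z : sqn z = 1 -> exists2 t, 0 <= t <= 2 * pi & z = eit t.
Proof.
case: z => a b; rewrite /sqn /= => ab1.
have a1 : -1 <= a <= 1.
  by rewrite -ler_norml -(ler_pXn2r (n := 2)) ?nnegrE// real_normK ?num_real//
     expr1n -ab1 lerDl sqr_ge0.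
have sa : sin (acos a) = `|b|.
  by rewrite sin_acos// -ab1 addrAC subrr add0r sqrtr_sqr.
have p0 := acos_ge0 a1; have pp := acos_lepi a1; have pi0 := pi_gt0 R.
have [b0|b0] := leP 0 b.
  exists (acos a); first by apply/andP; split; lra.
  by rewrite /eit acosK ?in_itv// sa ger0_norm.
exists (2 * pi - acos a); first by apply/andP; split; lra.
rewrite /eit addrC mulr_natl cosD2pi sinD2pi cosN sinN sa acosK ?in_itv//.
by rewrite ltr0_norm// opprK.
Qed.

(** Continuity in the two real coordinates, so that compactness of the disc can be taken from a
    square in [R * R]. *)
Definition ccontinuous_at (g : R[i] -> R) (z : R[i]) :=
  {for (Re z, Im z), continuous (fun p : R * R => g (p.1 +i* p.2))}.

Lemma ccontinuous_at_comp (T : topologicalType) (f : T -> R[i]) (g : R[i] -> R)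
    (x : T) :
  {for x, continuous (fun y => Re (f y))} ->
  {for x, continuous (fun y => Im (f y))} ->
  ccontinuous_at g (f x) -> {for x, continuous (g \o f)}.
Proof.
move=> cR cI cg.
have -> : g \o f =
    (fun p : R * R => g (p.1 +i* p.2)) \o (fun y => (Re (f y), Im (f y))).
  by apply/funext => y /=; case: (f y).
apply: continuous_comp; last exact: cg.
exact: (@cvg_pair _ _ _ _ (nbhs (Re (f x))) (nbhs (Im (f x)))).
Qed.

Lemma ccontinuous_at_affine (g : R[i] -> R) (a b z : R[i]) :
  ccontinuous_at g (a + z * b) -> ccontinuous_at (fun w => g (a + w * b)) z.
Proof.
case: z => x y cg; rewrite /ccontinuous_at.
apply: (ccontinuous_at_comp (f := fun p : R * R => a + (p.1 +i* p.2) * b)) => //.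
  case: a {cg} => a1 a2; case: b => b1 b2 /=; apply: cvgD; first exact: cvg_cst.
  by apply: cvgB; apply: cvgM; (try exact: cvg_cst);
    [exact: cvg_fst|exact: cvg_snd].
case: a {cg} => a1 a2; case: b => b1 b2 /=; apply: cvgD; first exact: cvg_cst.
by apply: cvgD; apply: cvgM; (try exact: cvg_cst);
  [exact: cvg_fst|exact: cvg_snd].
Qed.

Lemma continuous_circle (g : R[i] -> R) (a b : R[i]) :
  (forall t, ccontinuous_at g (a + eit t * b)) ->
  continuous (fun t => g (a + eit t * b)).
Proof.
move=> cg t.
apply: (ccontinuous_at_comp (f := fun t => a + eit t * b)) => //.
  case: a {cg} => a1 a2; case: b => b1 b2 /=; apply: cvgD; first exact: cvg_cst.
  by apply: cvgB; apply: cvgM; (try exact: cvg_cst);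
    [exact: continuous_cos|exact: continuous_sin].
case: a {cg} => a1 a2; case: b => b1 b2 /=; apply: cvgD; first exact: cvg_cst.
by apply: cvgD; apply: cvgM; (try exact: cvg_cst);
  [exact: continuous_cos|exact: continuous_sin].
Qed.

Definition local_submean (g : R[i] -> R) := forall z, sqn z < 1 ->
  exists2 rho, 0 < rho & forall b, sqn b < rho ^+ 2 ->
    g z <= cmean (fun t => g (z + eit t * b)).

(* [g + e |z|^2] satisfies a strict mean value inequality, so it has no interior maximum. *)
Lemma maximum_principle (g : R[i] -> R) (e : R) :
  (forall z, sqn z <= 1 -> ccontinuous_at g z) -> local_submean g ->
  0 < e -> exists2 t, 0 <= t <= 2 * pi & g 0 <= g (eit t) + e.
Proof.
move=> cg lg e0.
pose N (p : R * R) := p.1 ^+ 2 + p.2 ^+ 2.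
have cN : continuous N.
  by move=> p; apply: cvgD; apply: cvgM;
    [exact: cvg_fst|exact: cvg_fst|exact: cvg_snd|exact: cvg_snd].
pose K := [set p : R * R | N p <= 1].
have K0 : K !=set0 by exists (0, 0); rewrite /K/N /= expr0n addr0.
have cK : compact K.
  have cS := compact_setX (@segment_compact R (-1) 1) (@segment_compact R (-1) 1).
  apply: (subclosed_compact _ cS).
    apply: (preimage_closed (f := N) (D := [set x : R | x <= 1])).
    - by move=> p _; exact: cN.
    - exact: closed_le.
  have sq (x y : R) : x ^+ 2 + y ^+ 2 <= 1 -> -1 <= x <= 1.
    move=> xy; rewrite -ler_norml -(ler_pXn2r (n := 2)) ?nnegrE//.
    by rewrite real_normK ?num_real// expr1n (le_trans _ xy)// lerDl sqr_ge0.
  move=> [x y]; rewrite /K /N /= => xy; rewrite !in_itv /= (sq x y)//.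
  by rewrite (sq y x)// addrC.
pose H (p : R * R) := g (p.1 +i* p.2) + e * N p.
have cH : {within K, continuous H}.
  apply: continuous_in_subspaceT => p /[!inE] Kp.
  apply: cvgD; first by case: p Kp => x y Kp; exact: (cg (x +i* y)).
  by apply: cvgM; [exact: cvg_cst|exact: cN].
have [p /[!inE] Kp Hp] := compact_EVT_max K0 cK cH.
have Hz z : sqn z <= 1 -> g z + e * sqn z <= H p.
  by case: z => x y /= z1; apply: (Hp (x, y)); rewrite inE.
pose z0 := p.1 +i* p.2.
(* A maximum point of [H] on the unit circle gives the claim by comparison with the origin; an
   interior one is contradicted on a small circle. *)
have [zlt|zge] := ltP (sqn z0) 1; last first.
  have z1 : sqn z0 = 1 by apply/eqP; rewrite eq_le zge andbT.
  have [t t2 zE] := sqn1_eit z1; exists t => //.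
  have := Hz 0; rewrite /sqn /= expr0n addr0 ler01 mulr0 addr0 => /(_ isT).
  move/le_trans; apply; rewrite /H -/z0 -zE.
  by rewrite lerD2l -[leRHS]mulr1 ler_pM2l.
have [rho rho0 mv] := lg z0 zlt.
(* [s < rho] gives the mean value inequality; [s * 5 <= 1 - sqn z0] keeps the circle in the closed
   disc, because [s ^+ 2 + 4 * s <= 5 * s]. *)
pose s := Num.min (rho / 2) ((1 - sqn z0) / 5).
have s0 : 0 < s by rewrite lt_min !divr_gt0// subr_gt0.
have s_rho : s < rho by rewrite gt_min; apply/orP; left; lra.
have sq0 : 0 <= sqn z0 by rewrite addr_ge0// sqr_ge0.
have s1 : s * 5 <= 1 - sqn z0 by rewrite -ler_pdivlMr// ge_min lexx orbT.
(* The part of [sqn] on the circle that is linear in [s], up to the factor [2 * s]. Its mean is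
   zero, so averaging leaves the loss [e * s ^+ 2]. *)
pose k t := Re z0 * cos t + Im z0 * sin t.
have sqE t : sqn (z0 + eit t * s%:C) = sqn z0 + s ^+ 2 + 2 * s * k t.
  have -> : s ^+ 2 = s ^+ 2 * (cos t ^+ 2 + sin t ^+ 2).
    by rewrite cos2Dsin2 mulr1.
  by rewrite /sqn /k /eit; case: (z0) => x y /=; ring.
have in1 t : sqn (z0 + eit t * s%:C) <= 1.
  have ss : sqn (eit t * s%:C) <= s ^+ 2.
    by rewrite sqnM sqn_eit mul1r /sqn /= expr0n addr0.
  apply: le_trans (sqnD_le (ltW zlt) ss (ltW s0)) _.
  have : s ^+ 2 <= s by rewrite expr2 ger_pMl//; lra.
  by move=> ?; lra.
have sb : sqn (s%:C) < rho ^+ 2.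
  by rewrite /sqn /= expr0n addr0 ltr_pXn2r// nnegrE ltW.
have le t : g (z0 + eit t * s%:C) <=
    (g z0 - e * s ^+ 2) + (- (2 * e * s)) * k t.
  have := Hz _ (in1 t); rewrite sqE /H -/z0 -[N p]/(sqn z0).
  by move=> ?; lra.
have ck : continuous k.
  by move=> t; apply: cvgD; (apply: cvgM; first exact: cvg_cst);
    [exact: continuous_cos|exact: continuous_sin].
have : cmean (fun t => g (z0 + eit t * s%:C)) <=
    cmean (fun t => (g z0 - e * s ^+ 2) + (- (2 * e * s)) * k t).
  apply: le_cmean => //.
    by apply: continuous_circle => t; apply: cg; exact: in1.
  by move=> t; apply: cvgD; [exact: cvg_cst|apply: cvgM; [exact: cvg_cst|exact: ck]].
rewrite cmeanD; last 2 first.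
  by move=> t; exact: cvg_cst.
  by move=> t; apply: cvgM; [exact: cvg_cst|exact: ck].
rewrite cmean_cst cmeanZ// /k cmeanD; last 2 first.
  by move=> t; apply: cvgM; [exact: cvg_cst|exact: continuous_cos].
  by move=> t; apply: cvgM; [exact: cvg_cst|exact: continuous_sin].
rewrite !cmeanZ; [|exact: continuous_sin|exact: continuous_cos].
rewrite cmean_cos cmean_sin !mulr0 addr0 mulr0 addr0 => /(le_trans (mv _ sb)).
have : 0 < e * s ^+ 2 by rewrite mulr_gt0// exprn_gt0.
by move=> ? ?; exfalso; lra.
Qed.

(** Near each point of the segment one [d] serves a whole neighbourhood, and compactness makes it
    uniform. Only [s] is confined to the segment. *)
Lemma heine_cantor (P : R -> R) (a b e : R) : continuous P -> 0 < e ->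
  exists2 d, 0 < d & forall s t, a <= s <= b -> `|s - t| < d -> `|P s - P t| < e.
Proof.
move=> cP e0.
have /compact_near_coveringP cov := @segment_compact R a b.
have := cov R 0^'+ (fun d s => forall t, `|s - t| < d -> `|P s - P t| < e) _ _.
case.
  move=> x _; have /cvgrPdist_lt /(_ (e / 2)) := cP x.
  rewrite divr_gt0// => /(_ isT) /nbhs_ballP [r /= r0 rP].
  exists (ball x (r / 2), [set d | 0 < d < r / 2]) => /=.
    split; first by apply: nbhsx_ballx; rewrite divr_gt0.
    near=> d; apply/andP; split => //.
    by near: d; apply: nbhs_right_lt; rewrite divr_gt0.
  move=> [s d] [/= xs /andP[d0 dr]] t st; rewrite (splitr e).
  rewrite -(subrKA (P x)); apply: (le_lt_trans (ler_normD _ _)).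
  have r2 : r / 2 < r by lra.
  apply: ltrD; first by rewrite distrC; apply: rP; exact: lt_trans xs r2.
  apply: rP; rewrite /ball /= -(subrKA s); apply: (le_lt_trans (ler_normD _ _)).
  by rewrite (splitr r) ltrD// (lt_trans st).
move=> d /= d0 dP.
exists (d / 2); first by rewrite divr_gt0.
move=> s t sab st; apply: (dP (d / 2)) => //=.
  by rewrite sub0r normrN gtr0_norm ?divr_gt0//; lra.
by rewrite divr_gt0.
Unshelve. all: by end_near. Qed.

(* Averaging [g] over the rotations by the [N]-th roots of unity keeps the value
   at [0] and turns the maximum over the unit circle into a Riemann sum of the
   circle mean. *)
Lemma submean_local_global (g : R[i] -> R) :
  (forall z, sqn z <= 1 -> ccontinuous_at g z) -> local_submean g ->
  g 0 <= cmean (fun t => g (eit t)).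
Proof.
move=> cg lg; pose P t := g (eit t).
have cP : continuous P.
  have -> : P = (fun t => g (0 + eit t * 1)).
    by apply/funext => t; rewrite mulr1 add0r.
  by apply: continuous_circle => t; rewrite mulr1 add0r; apply: cg; rewrite sqn_eit.
have P2pi t : P (t + 2 * pi) = P t by rewrite /P eitD eit_2pi mulr1.
apply/ler_addgt0Pr => e e0.
(* Half of [e] pays for the maximum principle, half for the error of the Riemann sum. *)
have e20 : 0 < e / 2 by rewrite divr_gt0.
have [d d0 dP] := heine_cantor 0 (2 * pi) cP e20.
have [N N0 Nd] : exists2 N : nat, (0 < N)%N & 2 * pi / N%:R < d.
  exists (Num.truncn (2 * pi / d)).+1 => //.
  by rewrite ltr_pdivrMr// [ltRHS]mulrC -ltr_pdivrMr// truncnS_gt.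
have NR : 0 < N%:R :> R by rewrite ltr0n.
set h := 2 * pi / N%:R in Nd.
have h0 : 0 < h by rewrite divr_gt0// twopi_gt0.
have Nh : N%:R * h = 2 * pi by rewrite /h mulrC divfK// gt_eqF.
pose zeta (k : nat) := eit (k%:R * h).
pose G z := \sum_(k < N) N%:R^-1 * g (z * zeta k).
have sqz z k : sqn (z * zeta k) = sqn z by rewrite sqnM sqn_eit mulr1.
have cG z : sqn z <= 1 -> ccontinuous_at G z.
  move=> z1.
  suff : forall s : seq 'I_N,
      ccontinuous_at (fun w => \sum_(k <- s) N%:R^-1 * g (w * zeta k)) z.
    exact.
  elim=> [|k s IH].
    rewrite (_ : (fun w => _) = cst 0); first exact: cvg_cst.
    by apply/funext => w; rewrite big_nil.
  rewrite (_ : (fun w => _) = fun w => N%:R^-1 * g (0 + w * zeta k) +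
    \sum_(j <- s) N%:R^-1 * g (w * zeta j)); last first.
    by apply/funext => w; rewrite big_cons add0r.
  apply: cvgD; last exact: IH.
  apply: cvgM; first exact: cvg_cst.
  by apply: ccontinuous_at_affine; apply: cg; rewrite add0r sqz.
have lG : local_submean G.
  move=> z z1.
  have /choice[rho rhoP] : forall k : 'I_N, exists r : R, 0 < r /\
      forall b, sqn b < r ^+ 2 ->
        g (z * zeta k) <= cmean (fun t => g (z * zeta k + eit t * b)).
    by move=> k; have [|r r0 rP] := lg (z * zeta k); rewrite ?sqz//; exists r.
  have [s s0 s1] : exists2 s, 0 < s & s * 5 = 1 - sqn z.
    by exists ((1 - sqn z) / 5); rewrite ?divfK// divr_gt0// subr_gt0.
  (* One radius serves all [N] rotated centres; the default [s] keeps the circle in the closed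
     disc. *)
  pose r := \big[Num.min/s]_(k < N) rho k.
  have r0 : 0 < r by apply: lt_bigmin => // k _; have [] := rhoP k.
  exists r => // b br.
  have rs : r <= s by exact: bigmin_le_id.
  have in1 t : sqn (z + eit t * b) <= 1.
    have bs : sqn (eit t * b) <= s ^+ 2.
      rewrite sqnM sqn_eit mul1r; apply/ltW/(lt_le_trans br).
      by rewrite ler_sqr ?nnegrE ?(ltW r0) ?(ltW s0).
    have sq0 : 0 <= sqn z by rewrite addr_ge0// sqr_ge0.
    apply: le_trans (sqnD_le (ltW z1) bs (ltW s0)) _.
    have : s ^+ 2 <= s by rewrite expr2 ger_pMl//; lra.
    by move=> ?; lra.
  have ck (k : 'I_N) :
      continuous (fun t => g (z * zeta k + eit t * (b * zeta k))).
    apply: continuous_circle => t; apply: cg.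
    by rewrite mulrA -mulrDl sqz.
  rewrite (_ : (fun t => G _) = fun t =>
      \sum_(k < N) N%:R^-1 * g (z * zeta k + eit t * (b * zeta k))); last first.
    by apply/funext => t; apply: eq_bigr => k _; rewrite mulrDl mulrA.
  rewrite cmean_sum; last first.
    by move=> k t; apply: cvgM; [exact: cvg_cst|exact: ck].
  apply: ler_sum => k _; rewrite cmeanZ; last exact: ck.
  rewrite ler_pM2l ?invr_gt0//; have [rk0 ->//] := rhoP k.
  rewrite sqz (lt_le_trans br)// ler_sqr ?nnegrE; [|exact: ltW|exact: ltW].
  exact: bigmin_le_cond.
have [t /andP[t0 t2] Gt] := maximum_principle cG lG e20.
have G0 : G 0 = g 0.
  rewrite /G; under eq_bigr do rewrite mul0r.
  by rewrite sumr_const card_ord -[_ *+ _]mulr_natl mulrA mulfV ?mul1r// gt_eqF.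
pose S t := \sum_(k < N) P (t + k%:R * h).
have GS t' : G (eit t') = N%:R^-1 * S t'.
  by rewrite mulr_sumr; apply: eq_bigr => k _; rewrite /P eitD.
(* Shifting by [h] permutes the samples cyclically, by [2 * pi]-periodicity of [P]. *)
have Sh t' : S (t' + h) = S t'.
  have E : \sum_(k < N.+1) P (t' + k%:R * h) = S t' + P t'.
    by rewrite big_ord_recr /= Nh P2pi.
  move: E; rewrite big_ord_recl /= mul0r addr0 addrC => /addIr <-.
  by apply: eq_bigr => k _; rewrite /bump /= natrD mulrDl mul1r addrA.
have Smh (m : nat) t' : S (t' + m%:R * h) = S t'.
  elim: m t' => [|m IH] t'; first by rewrite mul0r addr0.
  by rewrite -natr1 mulrDl mul1r addrA Sh IH.
(* Reduction of [t] modulo [h]: now [beta + k%:R * h] lies in the same arc as [xi k], at distance at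
   most [h < d]. *)
pose m := Num.truncn (t / h); pose beta := t - m%:R * h.
have /andP[m1 m2] : m%:R <= t / h < m.+1%:R by apply: truncn_itv; rewrite divr_ge0// ltW.
have beta0 : 0 <= beta by rewrite subr_ge0 -ler_pdivlMr.
have betah : beta < h.
  by rewrite ltrBlDr -[X in X + _]mul1r -mulrDl -ltr_pdivrMr// nat1r.
have -> : (fun t => g (eit t)) = P by [].
have [xi xiP ->] := cmean_mvt N0 cP.
rewrite -G0; apply: (le_trans Gt); rewrite {2}(splitr e) addrA lerD2r GS.
rewrite -[t](subrK (m%:R * h)) -/beta Smh.
rewrite -lerBlDl -mulrBr -sumrB mulrC ler_pdivrMr// mulr_natr.
rewrite -[X in _ *+ X](card_ord N) -sumr_const; apply: ler_sum => k _.
have /andP[x1 x2] := xiP k (ltn_ord k); rewrite -/h in x1 x2.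
apply: le_trans (ler_norm _) _; rewrite distrC; apply/ltW/dP.
  rewrite (le_trans _ x1) ?(mulr_ge0 (ler0n _ _) (ltW h0))//=.
  by rewrite (le_trans x2)// -Nh ler_pM2r// ler_nat.
apply: le_lt_trans Nd; rewrite ler_norml; rewrite -natr1 mulrDl mul1r in x2.
by apply/andP; split; lra.
Qed.

End LocalToGlobal.

(** * Euclidean norm and distance *)

Section EuclideanNorm.
Variables (R : realType) (m : nat).
Implicit Types x y z : 'rV[R]_m.

Definition dotp x y : R := \sum_(i < m) x 0 i * y 0 i.

Lemma dotpE x y : dotp x y = (x *m y^T) 0 0.
Proof. by rewrite mxE; apply: eq_bigr => i _; rewrite mxE. Qed.

Lemma dotpC x y : dotp x y = dotp y x.
Proof. by apply: eq_bigr => i _; rewrite mulrC. Qed.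

Lemma dotpDl x y z : dotp (x + y) z = dotp x z + dotp y z.
Proof. by rewrite /dotp -big_split; apply: eq_bigr => i _; rewrite mxE mulrDl. Qed.

Lemma dotpZl a x y : dotp (a *: x) y = a * dotp x y.
Proof. by rewrite /dotp mulr_sumr; apply: eq_bigr => i _; rewrite mxE mulrA. Qed.

Lemma dotpDr x y z : dotp z (x + y) = dotp z x + dotp z y.
Proof. by rewrite dotpC dotpDl !(dotpC z). Qed.

Lemma dotpZr a x y : dotp y (a *: x) = a * dotp y x.
Proof. by rewrite dotpC dotpZl dotpC. Qed.

Lemma dotp_ge0 x : 0 <= dotp x x.
Proof. by apply: sumr_ge0 => i _; rewrite -expr2 sqr_ge0. Qed.

Lemma enormE x : enorm x = Num.sqrt (dotp x x).
Proof. by []. Qed.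

Lemma enorm_sqr x : enorm x ^+ 2 = dotp x x.
Proof. by rewrite enormE sqr_sqrtr// dotp_ge0. Qed.

Lemma enorm_ge0 x : 0 <= enorm x.
Proof. exact: sqrtr_ge0. Qed.

Lemma enormZ a x : enorm (a *: x) = `|a| * enorm x.
Proof. by rewrite !enormE dotpZl dotpZr mulrA -expr2 sqrtrM ?sqr_ge0// sqrtr_sqr. Qed.

Lemma enorm0 : enorm (0 : 'rV[R]_m) = 0.
Proof. by rewrite -(scale0r (0 : 'rV[R]_m)) enormZ normr0 mul0r. Qed.

Lemma enormN x : enorm (- x) = enorm x.
Proof. by rewrite -scaleN1r enormZ normrN1 mul1r. Qed.

Lemma enormBC x y : enorm (x - y) = enorm (y - x).
Proof. by rewrite -opprB enormN. Qed.

Lemma enorm_eq0 x : enorm x = 0 -> x = 0.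
Proof.
move=> x0; have : dotp x x = 0 by rewrite -enorm_sqr x0 expr0n.
move/psumr_eq0P => H; apply/rowP => i; rewrite mxE; apply/eqP.
by rewrite -sqrf_eq0 expr2 H// => j _; rewrite -expr2 sqr_ge0.
Qed.

(** Expand the nonnegative square of [enorm y *: x - enorm x *: y] and cancel the product of the
    norms. *)
Lemma cauchy_schwarz x y : dotp x y <= enorm x * enorm y.
Proof.
have [x0|x0] := eqVneq (enorm x) 0.
  by rewrite (enorm_eq0 x0) -(scale0r 0) dotpZl mul0r scale0r enorm0 mul0r.
have [y0|y0] := eqVneq (enorm y) 0.
  by rewrite (enorm_eq0 y0) -(scale0r 0) dotpZr mul0r scale0r enorm0 mulr0.
have xp : 0 < enorm x by rewrite lt_def x0 enorm_ge0.
have yp : 0 < enorm y by rewrite lt_def y0 enorm_ge0.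
have := dotp_ge0 (enorm y *: x + (- enorm x) *: y).
rewrite dotpDl !dotpZl !dotpDr !dotpZr -!enorm_sqr (dotpC y x) => H.
rewrite -(ler_pM2l (mulr_gt0 xp yp)); nra.
Qed.

Lemma ler_enormD x y : enorm (x + y) <= enorm x + enorm y.
Proof.
rewrite -(ler_pXn2r (n := 2)) ?nnegrE ?addr_ge0 ?enorm_ge0// sqrrD !enorm_sqr.
rewrite dotpDl !dotpDr (dotpC y x); have := cauchy_schwarz x y; lra.
Qed.

Lemma ler_enorm_dist z x y : enorm (x - y) <= enorm (x - z) + enorm (z - y).
Proof. by rewrite -(subrKA z) ler_enormD. Qed.

Lemma coord_le_enorm x i : `|x 0 i| <= enorm x.
Proof.
rewrite -(ler_pXn2r (n := 2)) ?nnegrE ?enorm_ge0// enorm_sqr real_normK ?num_real//.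
by rewrite /dotp (bigD1 i)//= -expr2 lerDl sumr_ge0// => j _; rewrite -expr2 sqr_ge0.
Qed.

Lemma coord_le_norm x i : `|x 0 i| <= `|x|.
Proof.
by rewrite [leRHS]/Num.Def.normr /= mx_normrE; apply/bigmax_geP; right; exists (0, i).
Qed.

Lemma norm_le_enorm x : `|x| <= enorm x.
Proof.
rewrite [leLHS]/Num.Def.normr /= mx_normrE; apply: bigmax_le; first exact: enorm_ge0.
by move=> [j i] _ /=; rewrite (ord1 j) coord_le_enorm.
Qed.

(** The sum of squares is at most [m] times the squared sup norm, and [m <= m ^ 2] avoids a square
    root. *)
Lemma enorm_le_norm x : enorm x <= m%:R * `|x|.
Proof.
rewrite -(ler_pXn2r (n := 2)) ?nnegrE ?enorm_ge0 ?mulr_ge0//.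
have [m0|m0] := posnP m.
  have -> : x = 0 by apply/rowP => i; have := ltn_ord i; rewrite [in X in (_ < X)%N]m0.
  by rewrite enorm0 normr0 mulr0.
rewrite enorm_sqr exprMn; apply: (@le_trans _ _ (\sum_(i < m) `|x| ^+ 2)).
  apply: ler_sum => i _; rewrite -expr2 -[_ ^+ 2]real_normK ?num_real//.
  by rewrite ler_sqr ?nnegrE// coord_le_norm.
rewrite sumr_const card_ord -[leLHS]mulr_natl ler_wpM2r ?sqr_ge0//.
by rewrite -natrX ler_nat -[leqLHS]expn1 leq_pexp2l.
Qed.

(** Bridge between the sup-norm topology and Euclidean balls. Dividing by [m.+1] rather than [m]
    covers dimension zero. *)
Lemma nbhs_eballP z (A : set 'rV[R]_m) :
  nbhs z A <-> exists2 r, 0 < r & eball z r `<=` A.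
Proof.
have bE (r : R) y : ball z r y = (`|y - z| < r).
  by rewrite -ball_normE /ball_ /= distrC.
split => [/nbhs_ballP[r /= r0 rA]|[r r0 rA]].
  exists r => // y zy; apply: rA; rewrite bE.
  by apply: le_lt_trans (norm_le_enorm _) _.
apply/nbhs_ballP; exists (r / m.+1%:R); first by rewrite /= divr_gt0.
move=> y; rewrite bE => yz; apply: rA; rewrite /eball /=.
apply: le_lt_trans (enorm_le_norm _) _.
rewrite ltr_pdivlMr// in yz; apply: le_lt_trans yz.
by rewrite mulrC ler_wpM2l// ler_nat.
Qed.

Lemma nbhs_eball z r : 0 < r -> nbhs z (eball z r).
Proof. by move=> r0; apply/nbhs_eballP; exists r. Qed.

Lemma eball_center z r : 0 < r -> eball z r z.
Proof. by rewrite /eball /= subrr enorm0. Qed.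

Lemma eball_open z r : open (eball z r).
Proof.
rewrite openE => y zy; apply/nbhs_eballP; exists (r - enorm (y - z)).
  by rewrite subr_gt0.
move=> v; rewrite /eball /= ltrBrDr; apply: le_lt_trans.
exact: ler_enorm_dist.
Qed.

Lemma enorm_lipschitz_continuous (T : normedModType R) (f : 'rV[R]_m -> T)
    (L : R) : (forall z y, `|f z - f y| <= L * enorm (z - y)) -> continuous f.
Proof.
move=> fL z; apply/(@cvgrPdist_lt _ _ _ (nbhs z) (nbhs_filter z)) => e e0; apply/nbhs_eballP.
exists (e / (`|L| + 1)) => [|y zy]; first by rewrite divr_gt0// ltr_wpDl.
apply: le_lt_trans (fL _ _) _.
apply: (@le_lt_trans _ _ ((`|L| + 1) * enorm (z - y))).
  by rewrite ler_wpM2r ?enorm_ge0// ler_wpDr// ler_norm.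
by rewrite mulrC -ltr_pdivlMr ?ltr_wpDl// enormBC.
Qed.

Lemma continuous_enorm : continuous (@enorm R m).
Proof.
apply: (@enorm_lipschitz_continuous _ _ 1) => z y; rewrite mul1r ler_norml.
have := ler_enorm_dist z y 0; have := ler_enorm_dist y z 0.
by rewrite !subr0 (enormBC y z) => *; apply/andP; split; lra.
Qed.

Lemma continuous_sqr_dist (l : R) z :
  continuous (fun y : 'rV[R]_m => l - enorm (y - z) ^+ 2).
Proof.
have cB : continuous (fun y : 'rV[R]_m => enorm (y - z)).
  move=> y; apply: (@continuous_comp _ _ _ (fun v : 'rV[R]_m => v - z) (@enorm R m)).
    by apply: (@cvgB _ _ _ (nbhs y)); [exact: cvg_id|exact: cvg_cst].
  exact: continuous_enorm.
move=> y; apply: (@cvgB _ _ _ (nbhs y)); first exact: cvg_cst.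
by apply: (@cvgM _ _ (nbhs y)); exact: cB.
Qed.

(** The ball is a union of segments issuing from its centre. *)
Lemma connected_eball z r : connected (eball z r).
Proof.
pose S y : set 'rV[R]_m := (fun t : R => z + t *: (y - z)) @` `[0, 1].
have [r0|r0] := ltP 0 r; last first.
  suff -> : eball z r = set0 by exact: connected0.
  rewrite -subset0 => y; rewrite /eball /= => yr.
  by move: (lt_le_trans yr r0); rewrite ltNge enorm_ge0.
suff -> : eball z r = \bigcup_(y in eball z r) S y.
  apply: bigcup_connected.
    exists z => y _; exists 0; first by rewrite /= in_itv /= lexx ler01.
    by rewrite scale0r addr0.
  move=> y _; apply: connected_continuous_connected; first exact: segment_connected.
  apply: continuous_subspaceT => t; apply: cvgD; first exact: cvg_cst.
  by apply: cvgZ; [exact: cvg_id|exact: cvg_cst].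
apply/seteqP; split => [y zy|y [v zv [t]]].
  exists y => //; exists 1; first by rewrite /= in_itv /= lexx ler01.
  by rewrite scale1r addrC subrK.
rewrite /= in_itv /= => /andP[t0 t1] <-; rewrite /eball /= addrC addKr enormZ.
apply: le_lt_trans zv; rewrite ger0_norm//.
by rewrite ler_piMl// enorm_ge0.
Qed.

End EuclideanNorm.

(** * Distance from a point to a set *)

Section PointDistance.
Variables (R : realType) (m : nat).
Implicit Types (x y z : 'rV[R]_m) (F : set 'rV[R]_m).

(** Real-valued counterpart of [set_dist]. The two agree on nonempty [F]; on the empty set [inf] is
    a default real number, not [+oo]. *)
Definition edist z F : R := inf [set enorm (z - y) | y in F].

Let has_lb z F : has_lbound [set enorm (z - y) | y in F].
Proof. by exists 0 => _ [y _ <-]; exact: enorm_ge0. Qed.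

Lemma edist_le z F y : F y -> edist z F <= enorm (z - y).
Proof. by move=> Fy; apply: ge_inf; [exact: has_lb|exists y]. Qed.

Lemma le_edist z F d : F !=set0 -> (forall y, F y -> d <= enorm (z - y)) ->
  d <= edist z F.
Proof.
move=> [y Fy] dF; apply: lb_le_inf; first by exists (enorm (z - y)), y.
by move=> _ [v Fv <-]; exact: dF.
Qed.

Lemma edist_lipschitz z y F : F !=set0 ->
  edist z F <= edist y F + enorm (z - y).
Proof.
move=> F0; rewrite -lerBlDr; apply: le_edist => // v Fv.
rewrite lerBlDr (le_trans (edist_le z Fv))// [leRHS]addrC.
exact: ler_enorm_dist.
Qed.

Lemma continuous_edist F : F !=set0 -> continuous (fun z => edist z F).
Proof.
move=> F0; apply: (@enorm_lipschitz_continuous _ _ _ _ 1) => z y.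
rewrite mul1r ler_norml; have := edist_lipschitz z y F0.
by have := edist_lipschitz y z F0; rewrite (enormBC y z) => *; apply/andP; split; lra.
Qed.

Lemma edist_gt0 z F : F !=set0 -> closed F -> ~ F z -> 0 < edist z F.
Proof.
move=> F0 /closed_openC oF nFz.
have /nbhs_eballP[r r0 rF] : nbhs z (~` F) by apply: open_nbhs_nbhs; split.
apply: lt_le_trans r0 _; apply: le_edist => // y Fy; rewrite leNgt.
by apply/negP => zy; apply: (rF y) => //; rewrite /eball /= enormBC.
Qed.

Lemma set_dist1E z F : F !=set0 -> set_dist [set z] F = (edist z F)%:E.
Proof.
move=> F0; rewrite /edist -ereal_inf_EFin//; last first.
  by case: F0 => y Fy; exists (enorm (z - y)), y.
congr ereal_inf; apply/seteqP; split => [_ [_ [y [-> Fy ->]]]|_ [_ [y Fy <-] <-]].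
  by exists (enorm (z - y)) => //; exists y.
by exists z, y.
Qed.

End PointDistance.

(** * Boundaries and connected sets *)

Section Topology.
Variable T : topologicalType.
Implicit Types A S : set T.

Lemma closure_boundary A z : closure A z -> A z \/ boundary A z.
Proof.
move=> cz; have [Az|nAz] := pselect (A z); [by left|right; split => //].
by move/interior_subset.
Qed.

Lemma boundary_not_open A z : open A -> boundary A z -> ~ A z.
Proof. by rewrite openE => oA [_ nz] /oA. Qed.

Lemma boundary_closed A : closed (boundary A).
Proof.
by apply: closedI; [exact: closed_closure|apply/open_closedC/open_interior].
Qed.

(** [S] meets [A] in a relatively open set, which is also relatively closed: [closure A] adds only
    boundary points, and [S] avoids them. *)
Lemma connected_avoiding_boundary A S : open A -> connected S ->
  S `&` A !=set0 -> S `&` boundary A = set0 -> S `<=` A.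
Proof.
move=> oA cS SA Sb.
suff <- : S `&` A = S by move=> ? [].
apply: cS => //; first by exists A.
exists (closure A); first exact: closed_closure.
apply/seteqP; split => z [Sz Az]; split => //; first exact: subset_closure.
have [//|bz] := closure_boundary Az.
by suff : set0 z by []; rewrite -Sb.
Qed.

End Topology.

(** * Plurisubharmonicity in terms of circle means *)

Lemma continuous_addr (R : realType) (T : topologicalType) (f g : T -> R) x :
  {for x, continuous f} -> {for x, continuous g} ->
  {for x, continuous (fun y => f y + g y)}.
Proof. exact: (@cvgD _ _ _ (nbhs x)). Qed.

Lemma continuous_mulr (R : realType) (T : topologicalType) (f g : T -> R) x :
  {for x, continuous f} -> {for x, continuous g} ->
  {for x, continuous (fun y => f y * g y)}.
Proof. exact: (@cvgM _ _ (nbhs x)). Qed.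

Section Submean.
Variables (R : realType) (n : nat).
Local Notation rV := 'rV[R]_(n + n).
Local Notation cV := 'rV[R[i]]_n.
Implicit Types (a b : cV) (z v : rV) (D U : set rV) (u : rV -> R).
Local Open Scope complex_scope.

Definition complexify z : cV :=
  \row_(j < n) (lsubmx z 0 j +i* rsubmx z 0 j).

Lemma complexifyK z : realify (complexify z) = z.
Proof.
rewrite -[RHS]hsubmxK; congr row_mx; apply/rowP => j; by rewrite !mxE.
Qed.

Lemma realifyD a b : realify (a + b) = realify a + realify b.
Proof.
by rewrite /realify add_row_mx -!map_mxD; congr row_mx;
  apply/rowP => j; rewrite !mxE; case: (a 0 j) => ? ?; case: (b 0 j).
Qed.

Lemma realifyZ (c : R[i]) b :
  realify (c *: b) = complex.Re c *: realify b + complex.Im c *: realify ('i *: b).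
Proof.
rewrite /realify !scale_row_mx add_row_mx; congr row_mx; apply/rowP => j;
  by rewrite !mxE; case: c => x y; case: (b 0 j) => p q /=; ring.
Qed.

Lemma enorm_realifyZ (c : R[i]) b :
  enorm (realify (c *: b)) ^+ 2 = sqn c * enorm (realify b) ^+ 2.
Proof.
rewrite !enorm_sqr /dotp /realify !big_split_ord /= -!big_split mulr_sumr /=.
apply: eq_bigr => j _; rewrite !row_mxEl !row_mxEr !mxE.
by case: c => x y; case: (b 0 j) => p q; rewrite /sqn /=; ring.
Qed.

Definition disc_in D a b := forall tau : R[i], `|tau| <= 1 -> D (realify (a + tau *: b)).

Definition submean_on D u := forall a b, disc_in D a b ->
  u (realify a) <= cmean (fun t => u (realify (a + eit t *: b))).

Lemma eit_norm (t : R) : `|eit t| <= 1.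
Proof. by rewrite sqn_le1E sqn_eit. Qed.

Lemma continuous_realify_line a b (T : topologicalType) (f : T -> R[i]) (p : T) :
  {for p, continuous (fun q => complex.Re (f q))} ->
  {for p, continuous (fun q => complex.Im (f q))} ->
  {for p, continuous (fun q => realify (a + f q *: b))}.
Proof.
move=> cR cI; rewrite (_ : (fun q => _) = fun q => realify a +
  (complex.Re (f q) *: realify b + complex.Im (f q) *: realify ('i *: b))); last first.
  by apply/funext => q; rewrite realifyD realifyZ.
apply: cvgD; first exact: cvg_cst.
by apply: cvgD; apply: cvgZ; (try exact: cvg_cst); [exact: cR|exact: cI].
Qed.

Lemma continuous_realify_circle D u a b :
  (forall z, D z -> {for z, continuous u}) -> disc_in D a b ->
  continuous (fun t => u (realify (a + eit t *: b))).
Proof.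
move=> cu dD t.
apply: (@continuous_comp _ _ _ (fun t => realify (a + eit t *: b)) u).
  by apply: continuous_realify_line; [exact: continuous_cos|exact: continuous_sin].
by apply: cu; apply: dD; exact: eit_norm.
Qed.

Lemma submeanD D u1 u2 :
  (forall z, D z -> {for z, continuous u1}) ->
  (forall z, D z -> {for z, continuous u2}) ->
  submean_on D u1 -> submean_on D u2 -> submean_on D (fun z => u1 z + u2 z).
Proof.
move=> c1 c2 s1 s2 a b dD; rewrite cmeanD.
- by rewrite lerD; [by []|exact: s1|exact: s2].
- exact: continuous_realify_circle c1 dD.
- exact: continuous_realify_circle c2 dD.
Qed.

Lemma submeanZ D u (l : R) : (forall z, D z -> {for z, continuous u}) ->
  0 <= l -> submean_on D u -> submean_on D (fun z => l * u z).
Proof.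
move=> c l0 s a b dD; rewrite cmeanZ ?ler_wpM2l//; first exact: s.
exact: continuous_realify_circle c dD.
Qed.

Lemma submean_translate D u v : submean_on D u ->
  submean_on [set z | D (z + v)] (fun z => u (z + v)).
Proof.
move=> s a b dD; have := s (a + complexify v) b.
rewrite realifyD complexifyK.
have E (tau : R[i]) : realify (a + complexify v + tau *: b) =
    realify (a + tau *: b) + v.
  by rewrite (addrAC a) (realifyD (a + _)) complexifyK.
under eq_fun do rewrite E.
by apply => tau t1; rewrite E; exact: dD.
Qed.

(* The points of a disc are [A + x B + y B'] with [x + i y] in the unit disc. *)
Lemma submean_of_minorant u : continuous u ->
  (forall A B B' : rV, exists p q : R, forall t,
    u A + p * cos t + q * sin t <= u (A + (cos t *: B + sin t *: B'))) ->
  submean_on setT u.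
Proof.
move=> cu min a b dT.
have [p [q pq]] := min (realify a) (realify b) (realify ('i *: b)).
have c1 : continuous (fun t : R => p * cos t).
  by move=> t; apply: cvgM; [exact: cvg_cst|exact: continuous_cos].
have c2 : continuous (fun t : R => q * sin t).
  by move=> t; apply: cvgM; [exact: cvg_cst|exact: continuous_sin].
have c3 : continuous (fun t : R => u (realify a) + p * cos t).
  by move=> t; apply: cvgD; [exact: cvg_cst|exact: c1].
(* The trigonometric terms have mean zero, so the minorant averages to [u] at the centre. *)
have : cmean (fun t => u (realify a) + p * cos t + q * sin t) = u (realify a).
  rewrite cmeanD// cmeanD//; last by move=> t; exact: cvg_cst.
  rewrite cmean_cst !cmeanZ; [|exact: continuous_sin|exact: continuous_cos].
  by rewrite cmean_cos cmean_sin !mulr0 !addr0.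
move=> {1}<-; apply: le_cmean.
- by move=> t; apply: cvgD; [exact: c3|exact: c2].
- by apply: (@continuous_realify_circle setT) => // z _; exact: cu.
- by move=> t; rewrite realifyD realifyZ.
Qed.

Lemma continuous_dotp (v : rV) : continuous (fun z => dotp z v).
Proof.
apply: (@enorm_lipschitz_continuous _ _ _ _ (enorm v)) => z y.
have -> : dotp z v - dotp y v = dotp (z - y) v.
  by rewrite dotpDl -(scaleN1r y) dotpZl mulN1r.
rewrite mulrC ler_norml cauchy_schwarz andbT lerNl.
rewrite -[X in X <= _]mulN1r -dotpZl scaleN1r.
by rewrite (le_trans (cauchy_schwarz _ _))// enormN.
Qed.

Lemma continuous_enorm_sqr : continuous (fun z : rV => enorm z ^+ 2).
Proof.
move=> z; apply: (@continuous_comp _ _ _ (@enorm R (n + n)) (fun x => x ^+ 2)).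
  exact: continuous_enorm.
exact: exprn_continuous.
Qed.

(** In the expansion of the squared norm around [A] the quadratic term is nonnegative; dropping it
    leaves a trigonometric minorant. *)
Lemma submean_enorm_sqr : submean_on setT (fun z => enorm z ^+ 2).
Proof.
apply: submean_of_minorant; first exact: continuous_enorm_sqr.
move=> A B B'; exists (2 * dotp A B), (2 * dotp A B') => t.
rewrite !enorm_sqr dotpDl (dotpDr _ _ A) (dotpC (_ + _) (A + _)) dotpDl.
have := dotp_ge0 (cos t *: B + sin t *: B').
set d := dotp (_ + _) (_ + _).
rewrite /d; set w := cos t *: B + sin t *: B'.
have -> : dotp A w = cos t * dotp A B + sin t * dotp A B'.
  by rewrite /w dotpDr !dotpZr.
by move=> ?; lra.
Qed.

Lemma submean_affine (v : rV) (l : R) : submean_on setT (fun z => dotp z v + l).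
Proof.
apply: submean_of_minorant.
  move=> z; apply: (@continuous_addr _ _ (fun z => dotp z v) (fun=> l)); first exact: continuous_dotp.
  exact: cst_continuous.
move=> A B B'; exists (dotp B v), (dotp B' v) => t.
by rewrite !dotpDl !dotpZl; lra.
Qed.

Lemma submean_cst D (l : R) : submean_on D (fun=> l).
Proof. by move=> a b _; rewrite cmean_cst. Qed.

Lemma submean_sub D D' u : D' `<=` D -> submean_on D u -> submean_on D' u.
Proof. by move=> DD s a b dD; apply: s => tau /dD /DD. Qed.

Lemma cmean_integral (h : R -> R) : continuous h ->
  (((2 * pi)^-1)%:E * \int[@lebesgue_measure R]_(t in `[0%R, (2 * pi)%R]) (h t)%:E
   = (cmean h)%:E)%E.
Proof.
move=> ch; rewrite /cmean EFinM /Rintegral fineK//.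
by apply: integrable_fin_num => //; exact: continuous_integrable_itv.
Qed.

Lemma plurisubharmonic_submean V D (phi : rV -> \bar R) u :
  plurisubharmonic V phi -> D `<=` V ->
  (forall z, D z -> phi z = (u z)%:E) ->
  (forall z, D z -> {for z, continuous u}) -> submean_on D u.
Proof.
move=> [_ _ _ mv] DV phiE cu a b dD; have := mv a b (fun tau t => DV _ (dD tau t)).
have E t : phi (realify (a + eit t *: b)) = (u (realify (a + eit t *: b)))%:E.
  by apply: phiE; apply: dD; exact: eit_norm.
have Ea : phi (realify a) = (u (realify a))%:E.
  by apply: phiE; have := dD 0; rewrite scale0r addr0 normr0 ler01; exact.
rewrite Ea; under eq_integral do rewrite -/(eit _) E.
rewrite cmean_integral ?lee_fin//; exact: continuous_realify_circle cu dD.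
Qed.

Lemma submean_plurisubharmonic D u : open D ->
  (forall z, D z -> {for z, continuous u}) -> submean_on D u ->
  plurisubharmonic D (EFin \o u).
Proof.
move=> oD cu su; split => //.
- by move=> z _; rewrite ltry.
- move=> z l Dz; rewrite /= lte_fin => ul.
  have : \forall y \near z, u y < l by apply: (cvgr_lt _ (cu z Dz)).
  by apply: filterS => y ? _; rewrite lte_fin.
- move=> a b dD /=; rewrite cmean_integral ?lee_fin//; first exact: su.
  exact: continuous_realify_circle cu dD.
Qed.

(** [v] touches [u] from below at [z], so its mean value inequality passes to [u] on small circles;
    on each complex line [submean_local_global] then reaches the whole disc. *)
Lemma locally_submean_submean U u :
  (forall z, U z -> {for z, continuous u}) ->
  (forall z, U z -> exists D (v : rV -> R), [/\ nbhs z D, submean_on D v,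
     forall y, D y -> {for y, continuous v},
     v z = u z & forall y, D y -> U y /\ v y <= u y]) ->
  submean_on U u.
Proof.
move=> cu lu a b dU.
pose g tau := u (realify (a + tau *: b)).
have -> : u (realify a) = g 0 by rewrite /g scale0r addr0.
apply: (submean_local_global (g := g)).
  move=> z z1; rewrite /ccontinuous_at.
  apply: (@continuous_comp _ _ _ (fun p : R * R => realify (a + (p.1 +i* p.2) *: b)) u).
    by apply: continuous_realify_line; [exact: cvg_fst|exact: cvg_snd].
  by apply: cu; apply: dU; rewrite sqn_le1E; move: z1; case: z.
move=> z z1.
have Uz : U (realify (a + z *: b)) by apply: dU; rewrite sqn_le1E ltW.
have [D [v [/nbhs_eballP[r r0 rD] sv cv vz vu]]] := lu _ Uz.
(* Adding 1 keeps [N] positive when [b = 0]. *)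
pose N := enorm (realify b) + 1.
have N0 : 0 < N by rewrite ltr_wpDl ?enorm_ge0.
have r'0 : 0 < r / N by rewrite divr_gt0.
exists (r / N) => // c cr.
have dD : disc_in D (a + z *: b) (c *: b).
  move=> tau; rewrite sqn_le1E => tau1; apply: rD; rewrite /eball /=.
  rewrite realifyD addrC addKr scalerA.
  rewrite -(ltr_pXn2r (n := 2)) ?nnegrE ?enorm_ge0 ?(ltW r0)// enorm_realifyZ sqnM.
  apply: (@le_lt_trans _ _ (sqn c * N ^+ 2)); last first.
    by rewrite -ltr_pdivlMr ?exprn_gt0// -expr_div_n.
  have sc : 0 <= sqn c by rewrite addr_ge0// sqr_ge0.
  apply: ler_pM.
  - by rewrite mulr_ge0// addr_ge0// sqr_ge0.
  - exact: sqr_ge0.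
  - by rewrite ler_piMl.
  - by rewrite ler_sqr ?nnegrE ?enorm_ge0 ?(ltW N0)// lerDl.
have zE t : realify (a + (z + eit t * c) *: b) =
    realify (a + z *: b + eit t *: (c *: b)).
  by rewrite scalerDl scalerA addrA.
rewrite /g -vz; apply: le_trans (sv _ _ dD) _.
apply: le_cmean; first exact: continuous_realify_circle cv dD.
  rewrite (_ : (fun t => _) = fun t => u (realify (a + z *: b + eit t *: (c *: b)))).
    by apply: (@continuous_realify_circle D) => // y /vu[/cu].
  by apply/funext => t; rewrite zE.
by move=> t; rewrite zE; apply: (vu _ _).2; apply: dD; exact: eit_norm.
Qed.

End Submean.

(** * Gluing and compactness *)

Section Gluing.
Variables (R : realType) (T : topologicalType) (I : finType).
Variables (U : set T) (D K : I -> set T) (u : I -> T -> R).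

Lemma active_max_exists : (forall z, U z -> exists i, D i z) ->
  exists psi : T -> R, forall z, U z ->
    (exists2 i, D i z & psi z = u i z) /\ (forall i, D i z -> u i z <= psi z).
Proof.
move=> UD.
suff /choice[psi psiP] : forall z, exists M : R, U z ->
    (exists2 i, D i z & M = u i z) /\ (forall i, D i z -> u i z <= M).
  by exists psi => z; exact: psiP.
move=> z; have [Uz|] := pselect (U z); last by exists 0.
have [i0 /asboolP Di0] := UD z Uz.
case: (@arg_maxP _ _ I i0 (fun i => `[< D i z >]) (fun i => u i z) Di0).
move=> i /asboolP Di imax; exists (u i z) => _; split; first by exists i.
by move=> j /asboolP Dj; exact: imax.
Qed.

(* A piece about to leave its domain lies outside its core [K i], where it is
   dominated by a piece that is inside its own core and hence persists. *)
Lemma active_max_continuous (psi : T -> R) : open U ->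
  (forall i, open (D i)) -> (forall i, K i `<=` D i) ->
  (forall i z, U z -> ~ K i z -> \forall y \near z, ~ K i y) ->
  (forall i z, D i z -> {for z, continuous (u i)}) ->
  (forall i y, U y -> D i y -> ~ K i y -> exists2 j, K j y & u i y <= u j y) ->
  (forall z, U z ->
    (exists2 i, D i z & psi z = u i z) /\ (forall i, D i z -> u i z <= psi z)) ->
  forall z, U z -> {for z, continuous psi}.
Proof.
move=> oU oD KD nK cu dom psiP z Uz.
apply/(@cvgrPdist_lt _ _ _ (nbhs z) (nbhs_filter z)) => e e0.
have nU : \forall y \near z, U y by apply: open_nbhs_nbhs.
have nD : \forall y \near z, forall i, D i z -> D i y /\ `|u i z - u i y| < e.
  apply: filter_forall => i; have [Di|] := pselect (D i z); last first.
    by move=> nDi; apply: nearW.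
  have nDi : \forall y \near z, D i y by apply: open_nbhs_nbhs.
  have nui : \forall y \near z, `|u i z - u i y| < e.
    by have /(@cvgrPdist_lt _ _ _ (nbhs z) (nbhs_filter z)) := cu i z Di; apply.
  by near=> y => _; split; near: y.
have nK' : \forall y \near z, forall i, ~ K i z -> ~ K i y.
  apply: filter_forall => i; have [Ki|/(nK i z Uz)] := pselect (K i z).
    by apply: nearW.
  by apply: filterS => y nKy _.
have [[i0 Di0 pz] max_z] := psiP z Uz.
near=> y.
have Uy : U y by near: y.
have Dy i : D i z -> D i y /\ `|u i z - u i y| < e by move: i; near: y.
have Ky i : ~ K i z -> ~ K i y by move: i; near: y.
have [[i Di py] max_y] := psiP y Uy.
(* The piece attaining the maximum at [z] is still active at [y]. *)
have lo : psi z - psi y < e.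
  have [Di0y] := Dy i0 Di0; rewrite ltr_norml => /andP[_].
  by have := max_y _ Di0y; rewrite pz; lra.
have hi j : D j z -> u j y < psi z + e.
  move=> Dj; have [_] := Dy j Dj; rewrite ltr_norml => /andP[+ _].
  by have := max_z _ Dj; lra.
(* If the piece attaining the maximum at [y] is inactive at [z], it is outside its core at [z],
   hence at [y]. Its dominator [j] is in its core at [y], hence at [z], and [hi] applies to [j]. *)
have hi' : psi y < psi z + e.
  rewrite py; have [/hi//|nDz] := pselect (D i z).
  have [j Kj le] := dom i y Uy Di (Ky i (fun Kz => nDz (KD i z Kz))).
  apply: le_lt_trans le _; apply: hi; apply: KD.
  by apply: contrapT => /Ky.
by rewrite ltr_norml lo andbT; lra.
Unshelve. all: by end_near. Qed.

End Gluing.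

(** * Uniform bounds from compactness *)

Section Compactness.
Variables (R : realType) (T : topologicalType).

(** Minima on compact sets are attained, so the strict bound survives; [c1] caps the result and
    replaces the minimum over an empty set. *)
Lemma compact_uniform_lower_bound (I : finType) (P : I -> set T)
    (F : I -> T -> R) (c0 c1 : R) :
  (forall i, compact (P i)) -> (forall i, continuous (F i)) -> c0 < c1 ->
  (forall i p, P i p -> c0 < F i p) ->
  exists2 mu, c0 < mu <= c1 & forall i p, P i p -> mu <= F i p.
Proof.
move=> cP cF c01 PF.
have /choice[mu muP] : forall i, exists mu, c0 < mu /\ forall p, P i p -> mu <= F i p.
  move=> i; have [P0|/set0P/negP] := pselect (P i !=set0); last first.
    by rewrite negbK => /eqP ->; exists c1.
  have [p /[!inE] Pp pmin] := compact_EVT_min P0 (cP i) (continuous_subspaceT (cF i)).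
  by exists (F i p); split=> [|q Pq]; [exact: PF|apply: pmin; rewrite inE].
exists (\big[Num.min/c1]_i mu i).
  apply/andP; split; last exact: bigmin_le_id.
  by apply: lt_bigmin => // i _; have [] := muP i.
move=> i p Pp; apply: (@le_trans _ _ (mu i)); first exact: bigmin_le_cond.
by have [_] := muP i; exact.
Qed.

(** A Lebesgue number argument: near each point some index keeps half of its positive value, and
    compactness makes the bound uniform. *)
Lemma compact_cover_margin (I : finType) (P : set T) (F : I -> T -> R) :
  compact P -> (forall i, continuous (F i)) ->
  (forall p, P p -> exists i, 0 < F i p) ->
  exists2 tau, 0 < tau & forall p, P p -> exists i, tau <= F i p.
Proof.
move=> /compact_near_coveringP cov cF PF.
have := cov R 0^'+ (fun d p => exists i, d <= F i p) _ _.
case.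
  move=> p /PF[i Fi].
  exists ([set q | F i p / 2 < F i q], [set d | 0 < d < F i p / 2]) => /=.
    split; first by apply: (cvgr_gt _ (cF i p)); lra.
    near=> d; apply/andP; split => //.
    by near: d; apply: nbhs_right_lt; rewrite divr_gt0.
  by move=> [q d] [/= Fq /andP[_ dF]]; exists i; lra.
move=> d /= d0 dP; exists (d / 2); first by rewrite divr_gt0.
move=> p Pp; apply: (dP (d / 2)) => //=.
  by rewrite sub0r normrN gtr0_norm ?divr_gt0//; lra.
by rewrite divr_gt0.
Unshelve. all: by end_near. Qed.

End Compactness.

Lemma bounded_closure_compact (R : realType) (m : nat) (A : set 'rV[R]_m) :
  bounded_set A -> compact (closure A) /\
  exists2 M : R, 0 <= M & forall z, closure A z -> enorm z <= M.
Proof.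
move=> bA.
have [M M0 AM] : exists2 M : R, 0 < M & forall z, A z -> `|z| <= M.
  have [M [_ MA]] := bA; exists (`|M| + 1); first by rewrite ltr_wpDl.
  by apply: MA; rewrite ltr_pwDr// ler_norm.
have cB : closed [set z : 'rV[R]_m | `|z| <= M].
  apply: (preimage_closed (f := fun z : 'rV[R]_m => `|z|) (D := [set x : R | x <= M])).
  - by move=> z _; exact: norm_continuous.
  - exact: closed_le.
have cAB : closure A `<=` [set z | `|z| <= M].
  rewrite [X in _ `<=` X](closure_id _).1//; exact: closure_subset.
split.
  apply: bounded_closed_compact; last exact: closed_closure.
  by exists M; split=> [|M' MM' z /cAB /= zM]; rewrite ?num_real// (le_trans zM)// ltW.
exists (m%:R * M); first by rewrite mulr_ge0// ltW.
move=> z /cAB /= zM; apply: le_trans (enorm_le_norm _) _.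
by rewrite ler_wpM2l.
Qed.

(** * Geometry of the boundary *)

Section FineFunctions.
Variables (R : realType) (m : nat).
Implicit Types (A : set 'rV[R]_m) (phi : 'rV[R]_m -> \bar R).

Lemma continuous_on_fine A phi : continuous_on A phi ->
  {within A, continuous (fine \o phi)} /\
  forall z, A z -> phi z = (fine (phi z))%:E.
Proof.
move=> [fin /subspace_continuousP cphi]; split=> [|z Az]; last by rewrite fineK ?fin.
apply/subspace_continuousP => z Az.
by apply: fine_cvg; rewrite /= fineK ?fin//; exact: cphi.
Qed.

Lemma continuous_on_EFin A (u : 'rV[R]_m -> R) : open A ->
  (forall z, A z -> {for z, continuous u}) -> continuous_on A (EFin \o u).
Proof.
move=> oA cu; split => //; rewrite continuous_open_subspace// => z /[!inE] Az.
apply: (@cvg_EFin _ _ (nbhs z)) => /=.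
    by apply: nearW.
  exact: cu.
Qed.

(** Compactness bounds the supremum above; a point of [A] keeps it from being [-oo]. *)
Lemma modulus_fin A phi (t : R) : compact A -> A !=set0 ->
  continuous_on A phi -> 0 <= t ->
  exists2 l : R, modulus phi A t = l%:E &
    forall z zeta, A z -> A zeta -> enorm (z - zeta) <= t ->
      `|fine (phi z) - fine (phi zeta)| <= l.
Proof.
move=> cA [z0 Az0] cphi t0; have [cf phiE] := continuous_on_fine cphi.
have [M AM] : exists M : R, forall z, A z -> `|fine (phi z)| <= M.
  have [M [_ MA]] := compact_bounded (continuous_compact cf cA).
  exists (`|M| + 1) => z Az; apply: (MA (`|M| + 1)); last by exists z.
  by rewrite ltr_pwDr// ler_norm.
have diffE z zeta : A z -> A zeta ->
    `|phi z - phi zeta|%E = `|fine (phi z) - fine (phi zeta)|%:E.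
  by move=> Az Azeta; rewrite (phiE z Az) (phiE zeta Azeta).
have lb : (0%:E <= modulus phi A t)%E.
  apply: ereal_sup_ubound; exists z0, z0; split => //; first by rewrite subrr enorm0.
  by rewrite diffE// subrr normr0.
have ub : (modulus phi A t <= (M + M)%:E)%E.
  apply: ge_ereal_sup => _ [z [zeta [Az Azeta _ ->]]]; rewrite diffE// lee_fin.
  by rewrite (le_trans (ler_normB _ _))// lerD// AM.
have mfin : modulus phi A t \is a fin_num.
  by rewrite ge0_fin_numE// (le_lt_trans ub) ?ltry.
exists (fine (modulus phi A t)); first by rewrite fineK.
move=> z zeta Az Azeta zt; rewrite -lee_fin fineK// -diffE//.
by apply: ereal_sup_ubound; exists z, zeta.
Qed.

End FineFunctions.

(** * Moving inward from the graph *)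

Section Graph.
Variables (R : realType) (m k : nat) (Omega : set 'rV[R]_m).
Variables (x : 'I_k -> 'rV[R]_m) (r : 'I_k -> R) (w : 'I_k -> 'rV[R]_m).
Hypothesis HC0 : C0_boundary Omega x r w.
Hypothesis oO : open Omega.

Lemma direction_unit j : enorm (w j) = 1.
Proof.
have [_ _ graph] := HC0; have [orig [V [g [[_ _ ww] _ _ _]]]] := graph j.
by rewrite enormE dotpE ww mxE eqxx sqrtr1.
Qed.

Lemma enorm_step j (t : R) : 0 <= t -> enorm (t *: w j) = t.
Proof. by move=> t0; rewrite enormZ direction_unit mulr1 ger0_norm. Qed.

(** Moving along [w j] raises the last coordinate by [t] and fixes the others, so a point on or
    above the graph ends strictly above it. Both points stay in the ball of radius [4 * r j]. *)
Lemma inward_step j z (t : R) : closure Omega z -> enorm (z - x j) < r j ->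
  0 < t -> t <= r j -> Omega (z + t *: w j).
Proof.
move=> cz zx t0 tr.
have [_ _ graph] := HC0; have [orig [V [g [[_ Vw ww] _ OE bE]]]] := graph j.
have rj : 0 < r j by apply: lt_le_trans tr.
have z4 : eball (x j) (4 * r j) z by rewrite /eball /=; lra.
have z4' : eball (x j) (4 * r j) (z + t *: w j).
  rewrite /eball /= addrAC (le_lt_trans (ler_enormD _ _))//.
  by rewrite enorm_step ?ltW//; lra.
have cE : coord' orig V (z + t *: w j) = coord' orig V z.
  rewrite /coord' addrAC mulmxDl -scalemxAl.
  by rewrite -[w j *m V^T]trmxK trmx_mul trmxK Vw trmx0 scaler0 addr0.
have lE : coord_last orig (w j) (z + t *: w j) = coord_last orig (w j) z + t.
  rewrite /coord_last addrAC mulmxDl -scalemxAl ww mxE; congr (_ + _).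
  by rewrite !mxE mulr1.
have gz : g (coord' orig V z) <= coord_last orig (w j) z.
  have [Oz|bz] := closure_boundary cz.
    by have : (Omega `&` eball (x j) (4 * r j)) z by []; rewrite OE => -[/ltW].
  by have : (boundary Omega `&` eball (x j) (4 * r j)) z by []; rewrite bE => -[->].
suff : (Omega `&` eball (x j) (4 * r j)) (z + t *: w j) by case.
by rewrite OE; split => //=; rewrite cE lE (le_lt_trans gz)// ltrDl.
Qed.

End Graph.

(** * Balls near the boundary and neighbourhoods of the set *)

Section Boundary.
Variables (R : realType) (m : nat) (Omega : set 'rV[R]_m).
Hypothesis oO : open Omega.

(** Otherwise the ball about [y], connected and containing [y0], would avoid the boundary and lie in
    [Omega]. *)
Lemma eball_boundary y y0 mu : Omega y0 -> enorm (y0 - y) < mu -> ~ Omega y ->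
  exists2 p, boundary Omega p & enorm (p - y) < mu.
Proof.
move=> Oy0 y0y nOy; apply: contrapT => nb; apply: nOy.
have mu0 : 0 < mu by apply: le_lt_trans y0y; exact: enorm_ge0.
apply: (connected_avoiding_boundary oO (@connected_eball R m y mu)).
- by exists y0.
- by rewrite -subset0 => p [py bp]; apply: nb; exists p.
- exact: eball_center.
Qed.

Lemma eball_edist a mu : Omega a -> 0 < mu -> mu <= edist a (boundary Omega) ->
  eball a mu `<=` Omega.
Proof.
move=> Oa mu0 mud; apply: connected_avoiding_boundary => //.
- exact: connected_eball.
- by exists a; split => //; exact: eball_center.
- rewrite -subset0 => p [pa bp]; have := edist_le a bp.
  by rewrite enormBC => /(le_trans mud); rewrite leNgt pa.
Qed.

(** The open [mu]-neighbourhood of [Omega], on which the approximating function will live. *)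
Definition fattening mu : set 'rV[R]_m := \bigcup_(y in Omega) eball y mu.

Lemma fattening_open mu : open (fattening mu).
Proof. by apply: bigcup_open => y _; exact: eball_open. Qed.

Lemma fattening_connected mu : 0 < mu -> connected Omega -> connected (fattening mu).
Proof.
move=> mu0 cO; have [->|/set0P[y0 Oy0]] := eqVneq (fattening mu) set0.
  exact: connected0.
have {y0 Oy0}[y0 Oy0] : Omega !=set0 by case: Oy0 => y Oy _; exists y.
(* Each ball joined with [Omega] is connected, and all these unions share [y0]. *)
have -> : fattening mu = \bigcup_(y in Omega) (Omega `|` eball y mu).
  apply/seteqP; split => z [y Oy].
    by exists y => //; right.
  move=> [Oz|]; last by exists y.
  by exists z => //; exact: eball_center.
apply: bigcup_connected; first by exists y0 => y _; left.
move=> y Oy; apply: connectedU => //; last exact: connected_eball.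
by exists y; split => //; exact: eball_center.
Qed.

Lemma closure_fattening mu : 0 < mu -> closure Omega `<=` fattening mu.
Proof.
move=> mu0 z /(_ _ (nbhs_eball z mu0))[y [Oy yz]]; exists y => //.
by rewrite /eball /= enormBC.
Qed.

Lemma fattening_dist mu : (mu%:E <= set_dist Omega (boundary (fattening mu)))%E.
Proof.
apply: le_ereal_inf_tmp => _ [z [y [Oz by_ ->]]]; rewrite lee_fin leNgt.
apply/negP => zy; have nF := boundary_not_open (@fattening_open mu) by_; apply: nF.
by exists z => //; rewrite /eball /= enormBC.
Qed.

End Boundary.

(** * The approximating function *)

Section Construction.
Variables (R : realType) (n k : nat) (Omega : set 'rV[R]_(n + n)).
Variables (x : 'I_k -> 'rV[R]_(n + n)) (r : 'I_k -> R).
Variables (w : 'I_k -> 'rV[R]_(n + n)) (s : 'I_k -> R).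
Hypothesis oO : open Omega.
Hypothesis HC0 : C0_boundary Omega x r w.
Hypothesis s_itv : forall j, 0 < s j <= r j.

(** [tau] measures the room the cover leaves at the boundary, [h] is a displacement costing at most
    [tau / 4] of it, and [mu] is the width of the neighbourhood of [Omega]. *)
Variables tau h eps mu : R.
Hypothesis tau0 : 0 < tau.
Hypothesis margin : forall p, boundary Omega p ->
  exists i, 4 * tau <= s i ^+ 2 - enorm (p - x i) ^+ 2.
Hypothesis h_r : forall j, h <= r j.
Hypothesis shift : forall j v v', enorm (v - x j) <= s j -> enorm (v' - v) <= h ->
  enorm (v' - x j) ^+ 2 <= enorm (v - x j) ^+ 2 + tau / 4.
Hypotheses (eps0 : 0 < eps) (eps_h : 2 * eps <= h).
Hypotheses (mu0 : 0 < mu) (mu_eps : mu <= 2 * eps).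
Hypothesis mu_in : forall j p, boundary Omega p ->
  enorm (p - x j) ^+ 2 <= s j ^+ 2 - tau / 2 ->
  eball (p + (2 * eps) *: w j) mu `<=` Omega.

Variables (phi : 'rV[R]_(n + n) -> \bar R) (l : R).
Hypothesis pshphi : psh_near (closure Omega) phi.
Hypothesis cphi : continuous_on (closure Omega) phi.
Hypothesis l_mod : forall z zeta, closure Omega z -> closure Omega zeta ->
  enorm (z - zeta) <= eps -> `|fine (phi z) - fine (phi zeta)| <= l.

Let F z := fine (phi z).
(** [A * tau = 8 * l] is twice the error bound [4 * l] of a translate in [base_point]. *)
Let A := 8 * l / tau.
Let U := fattening Omega mu.
Let q j z := s j ^+ 2 - tau - enorm (z - x j) ^+ 2.
Let shifted j z := z + (2 * eps) *: w j.

(** [D i] is where a piece is active: [None] stands for [phi] itself, [Some j] for its [j]-th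
    translate. *)
Let D (i : option 'I_k) : set 'rV[R]_(n + n) :=
  if i is Some j then U `&` [set z | 0 < q j z] else Omega.
(** The cores: a translate leaves its core when its weight falls below [tau / 2], and [phi] does so
    within distance [h] of the boundary. *)
Let K (i : option 'I_k) : set 'rV[R]_(n + n) :=
  if i is Some j then U `&` [set z | tau / 2 <= q j z]
  else Omega `&` [set z | forall p, boundary Omega p -> h <= enorm (p - z)].
(* On [D (Some j)] the weight [q j z + |z|^2] is an affine function of [z]. *)
Let u (i : option 'I_k) z :=
  if i is Some j then
    F (shifted j z) + A * (dotp z (2 *: x j) + (s j ^+ 2 - tau - enorm (x j) ^+ 2))
  else F z + A * (enorm z ^+ 2 + tau).

Local Ltac slra := have := eps0; have := eps_h; have := mu0; have := mu_eps;
  have := tau0; lra.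

Let weightE j z : dotp z (2 *: x j) + (s j ^+ 2 - tau - enorm (x j) ^+ 2) =
  q j z + enorm z ^+ 2.
Proof.
rewrite /q dotpZr !enorm_sqr -(scaleN1r (x j)) !(dotpDl, dotpDr, dotpZl, dotpZr).
by rewrite (dotpC (x j) z); slra.
Qed.

Let OU : Omega `<=` U.
Proof. by move=> z Oz; exists z => //; exact: eball_center. Qed.

Let cOU : closure Omega `<=` U.
Proof. exact: closure_fattening. Qed.

Let Oc z : Omega z -> closure Omega z.
Proof. exact: subset_closure. Qed.

Let bc z : boundary Omega z -> closure Omega z.
Proof. by case. Qed.

Let sqr_lt (j : 'I_k) (v : 'rV[R]_(n + n)) : enorm v ^+ 2 < s j ^+ 2 -> enorm v < s j.
Proof.
have /andP[s0 _] := s_itv j.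
by rewrite ltr_pXn2r// nnegrE ?enorm_ge0// ltW.
Qed.

Let mid z j : shifted j z = (z + eps *: w j) + eps *: w j.
Proof. by rewrite /shifted mulr2n mulrDl mul1r scalerDl addrA. Qed.

Let l_ge0 : Omega !=set0 -> 0 <= l.
Proof.
move=> [z Oz]; have := l_mod (Oc Oz) (Oc Oz); rewrite !subrr enorm0 normr0.
by apply; exact: ltW.
Qed.

(** [l] controls only displacements up to [eps], so a longer move passes through a midpoint that
    must also lie in the closure. *)
Let two_steps a b c : closure Omega a -> closure Omega b -> closure Omega c ->
  enorm (a - b) <= eps -> enorm (b - c) <= eps -> `|F a - F c| <= 2 * l.
Proof.
move=> ca cb cc ab bc'; rewrite -(subrKA (F b)) (le_trans (ler_normD _ _))//.
by rewrite mulr2n mulrDl mul1r lerD// l_mod.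
Qed.

Let step_le j : eps <= r j /\ 2 * eps <= r j.
Proof. by have := h_r j; split; slra. Qed.

Let inner j y : closure Omega y -> enorm (y - x j) ^+ 2 < s j ^+ 2 ->
  Omega (shifted j y) /\ `|F (shifted j y) - F y| <= 2 * l.
Proof.
move=> cy /sqr_lt ys; have /andP[_ sr] := s_itv j.
have [e1 e2] := step_le j.
have yr : enorm (y - x j) < r j by apply: lt_le_trans sr.
have O1 : Omega (y + eps *: w j) by exact: (inward_step HC0).
have O2 : Omega (shifted j y) by apply: (inward_step HC0) => //; rewrite mulr_gt0.
split => //; apply: (@two_steps _ (y + eps *: w j)); rewrite ?mid.
- by rewrite -mid; exact: Oc.
- exact: Oc.
- by [].
- by rewrite addrC addKr (enorm_step HC0) ?lexx// ltW.
- by rewrite addrC addKr (enorm_step HC0) ?lexx// ltW.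
Qed.

Let q_move j v v' : enorm (v - x j) <= s j -> enorm (v' - v) <= h ->
  q j v - tau / 4 <= q j v'.
Proof. by move=> vs vh; have := shift vs vh; rewrite /q; slra. Qed.

(* Outside [Omega] the base point is a nearby boundary point; it does not depend on [j]. *)
Let base_point y : U y -> exists zeta, [/\ closure Omega zeta,
  (Omega y -> zeta = y), (~ Omega y -> boundary Omega zeta /\ enorm (zeta - y) < mu) &
  forall j, 0 < q j y ->
    Omega (shifted j y) /\ `|F (shifted j y) - F zeta| <= 4 * l].
Proof.
move=> [y0 Oy0 yy0]; have l0 : 0 <= l by apply: l_ge0; exists y0.
have [Oy|nOy] := pselect (Omega y).
  exists y; split => // [|j qj]; first exact: Oc.
  have [|? ?] := @inner j y (Oc Oy); first by move: qj; rewrite /q; slra.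
  by split => //; slra.
have [p bp py] : exists2 p, boundary Omega p & enorm (p - y) < mu.
  by apply: (@eball_boundary _ _ _ oO y y0) => //; rewrite enormBC.
exists p; split => // [|j qj]; first exact: bc.
have ys : enorm (y - x j) <= s j.
  by apply/ltW/sqr_lt; move: qj; rewrite /q; slra.
have qp : q j y - tau / 4 <= q j p by apply: q_move => //; slra.
have ps : enorm (p - x j) ^+ 2 <= s j ^+ 2 - tau / 2 by move: qp qj; rewrite /q; slra.
have [|Op Fp] := @inner j p (bc bp); first by move: ps; slra.
have sub := mu_in bp ps; rewrite -/(shifted j p) in sub.
(* Midpoint of the two translates. It lies in the ball given by [mu_in], and both halves are shorter
   than [mu / 2 <= eps]. *)
pose c := shifted j p + 2^-1 *: (y - p).
have sE : shifted j y = shifted j p + (y - p).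
  by rewrite /shifted [RHS]addrAC addrCA subrr addr0.
have yp : enorm (y - p) < mu by rewrite enormBC.
have nhalf : enorm (2^-1 *: (y - p)) < mu / 2.
  by rewrite enormZ ger0_norm ?invr_ge0// mulrC ltr_pM2r ?invr_gt0.
have Oc' : Omega c by apply: sub; rewrite /eball /c /= addrC addKr; slra.
have Os : Omega (shifted j y) by apply: sub; rewrite /eball sE /= addrC addKr.
split => //.
have two : `|F (shifted j y) - F (shifted j p)| <= 2 * l.
  apply: (@two_steps _ c); try exact: Oc.
    rewrite sE /c opprD addrACA subrr add0r.
    have -> : y - p - 2^-1 *: (y - p) = 2^-1 *: (y - p).
      by rewrite -[X in X - _]scale1r -scalerBl; congr (_ *: _); slra.
    by slra.
  by rewrite /c addrC addKr; slra.
rewrite -(subrKA (F (shifted j p))) (le_trans (ler_normD _ _))//.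
slra.
Qed.

(** On the closure [z] is its own base point, so a translate costs only [2 * l]; [b] isolates the
    weight to be bounded later. *)
Let closure_bound i z : closure Omega z -> D i z ->
  exists2 b, `|u i z - F z - A * b| <= 2 * l &
   b = (if i is Some j then q j z else tau) + enorm z ^+ 2.
Proof.
move=> cz; case: i => [j|] /=.
  move=> [_ qz]; have [|_ Fz] := @inner j z cz; first by move: qz; rewrite /q /=; slra.
  exists (q j z + enorm z ^+ 2) => //; rewrite weightE.
  by rewrite addrAC addrK.
move=> Oz; exists (tau + enorm z ^+ 2) => //.
have -> : F z + A * (enorm z ^+ 2 + tau) - F z - A * (tau + enorm z ^+ 2) = 0 by ring.
rewrite normr0.
by apply: mulr_ge0 => //; apply: l_ge0; exists z.
Qed.

Let continuous_q j : continuous (q j).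
Proof. exact: continuous_sqr_dist. Qed.

Let open_D i : open (D i).
Proof.
case: i => [j|//] /=; apply: openI; first exact: fattening_open.
apply: (@open_comp _ _ (q j) [set t | 0 < t]); last exact: open_gt.
by move=> z _; exact: continuous_q.
Qed.

Let KD i : K i `<=` D i.
Proof. by case: i => [j|] z [] //= Uz; split => //=; slra. Qed.

(** A point of [Omega] outside the core is near the boundary by definition; a point of [U] outside
    [Omega] is within [mu <= h] of it. *)
Let near_boundary y : U y -> ~ K None y ->
  exists2 p, boundary Omega p & enorm (p - y) < h.
Proof.
move=> Uy nK; have [Oy|nOy] := pselect (Omega y).
  apply: contrapT => nb; apply: nK; split => // p bp; rewrite leNgt.
  by apply/negP => py; apply: nb; exists p.
case: Uy => y0 Oy0 yy0.
have [|p bp py] := @eball_boundary _ _ _ oO y y0 mu Oy0 _ nOy.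
  by rewrite enormBC.
by exists p => //; apply: lt_le_trans py _; slra.
Qed.

Let near_notK i z : U z -> ~ K i z -> \forall y \near z, ~ K i y.
Proof.
case: i => [j|] Uz nK.
  have qz : q j z < tau / 2 by rewrite ltNge; apply/negP => ?; exact: nK.
  have : \forall y \near z, q j y < tau / 2.
    have cq : q j @ z --> q j z by exact: continuous_q.
    exact: (cvgr_lt _ cq _ qz).
  by apply: filterS => y qy [_ /=]; rewrite leNgt qy.
have [p bp pz] := near_boundary Uz nK.
have : \forall y \near z, eball p h y.
  by apply: open_nbhs_nbhs; split; [exact: eball_open|rewrite /eball /= enormBC].
by apply: filterS => y py [_ /(_ p bp)]; rewrite leNgt enormBC py.
Qed.

Let continuous_F z : Omega z -> {for z, continuous F}.
Proof.
move=> Oz; have [cF _] := continuous_on_fine cphi.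
have : {within Omega, continuous (fine \o phi)}.
  by apply: continuous_subspaceW cF => y /Oc.
by rewrite continuous_open_subspace// => /(_ z); apply; rewrite inE.
Qed.

Let continuous_translate (v z : 'rV[R]_(n + n)) : {for z, continuous (fun y : 'rV[R]_(n + n) => y + v)}.
Proof. by apply: (@cvgD _ _ _ (nbhs z)); [exact: cvg_id|exact: cvg_cst]. Qed.

Let shifted_in j z : D (Some j) z -> Omega (shifted j z).
Proof.
move=> [Uz qz]; have [zeta [_ _ _ /(_ j qz)[//]]] := base_point Uz.
Qed.

Let continuous_weight i :
  continuous (fun z : 'rV[R]_(n + n) => if i is Some j then
     dotp z (2 *: x j) + (s j ^+ 2 - tau - enorm (x j) ^+ 2) else enorm z ^+ 2 + tau).
Proof.
case: i => [j|] z.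
  apply: (@continuous_addr _ _ (fun z => dotp z (2 *: x j)) (fun=> _)).
    exact: continuous_dotp.
  exact: cst_continuous.
apply: (@continuous_addr _ _ (fun z => enorm z ^+ 2) (fun=> tau)).
  exact: continuous_enorm_sqr.
exact: cst_continuous.
Qed.

Let continuous_main i z : D i z ->
  {for z, continuous (fun z : 'rV[R]_(n + n) => if i is Some j then F (shifted j z) else F z)}.
Proof.
case: i => [j|] Dz; last exact: continuous_F.
apply: (@continuous_comp _ _ _ (shifted j) F); first exact: continuous_translate.
exact: continuous_F (shifted_in Dz).
Qed.

(** Separates the values of [phi] from the weight, so that sums and multiples can be treated
    uniformly in [i]. *)
Let uE i : u i = fun z => (if i is Some j then F (shifted j z) else F z) +
  A * (if i is Some j then
     dotp z (2 *: x j) + (s j ^+ 2 - tau - enorm (x j) ^+ 2) else enorm z ^+ 2 + tau).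
Proof. by case: i. Qed.

Let continuous_u i z : D i z -> {for z, continuous (u i)}.
Proof.
move=> Dz; rewrite uE; apply: continuous_addr; first exact: continuous_main.
apply: (@continuous_mulr _ _ (fun=> A)); first exact: cst_continuous.
exact: continuous_weight.
Qed.

(** Translation preserves the inequality for [phi]; the weight is affine, or [enorm z ^+ 2 + tau],
    and its factor [A] is nonnegative. *)
Let submean_u i : Omega !=set0 -> submean_on (D i) (u i).
Proof.
move=> O0; have A0 : 0 <= A by rewrite divr_ge0 ?(ltW tau0)// mulr_ge0// l_ge0.
have sF : submean_on Omega F.
  have [V [cOV pV]] := pshphi.
  apply: (plurisubharmonic_submean pV); first by move=> z /Oc /cOV.
  - by move=> z /Oc Oz; have [_ ->] := continuous_on_fine cphi.
  - by move=> z; exact: continuous_F.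
rewrite uE; apply: submeanD.
- by move=> z; exact: continuous_main.
- move=> z _; apply: (@continuous_mulr _ _ (fun=> A)); first exact: cst_continuous.
  exact: continuous_weight.
- case: i => [j|//]; apply: (@submean_sub _ _ [set z | Omega (shifted j z)]).
    by move=> z; exact: shifted_in.
  exact: submean_translate.
- apply: submeanZ => //; first by move=> z _; exact: continuous_weight.
  case: i => [j|]; apply: (@submean_sub _ _ setT) => //.
    exact: submean_affine.
  apply: submeanD.
  + by move=> z _; exact: continuous_enorm_sqr.
  + by move=> z _; exact: cst_continuous.
  + exact: submean_enorm_sqr.
  + exact: submean_cst.
Qed.

(** Relative to the base point and without the common term in [enorm y ^+ 2], a translate outside
    its core is at most [8 * l] and [phi] in [Omega] equals [8 * l], while a translate with
    [2 * tau <= q j y] is at least [16 * l - 4 * l]. *)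
Let dominated i y : U y -> D i y -> ~ K i y -> exists2 j, K j y & u i y <= u j y.
Proof.
move=> Uy Diy nKy; have [zeta [_ zO _ zF]] := base_point Uy.
have l0 : 0 <= l by apply: l_ge0; case: Uy => y0 ?; exists y0.
have At : A * tau = 8 * l by rewrite /A divfK// gt_eqF.
have A0 : 0 <= A by rewrite /A divr_ge0 ?mulr_ge0// ltW.
(* At a boundary point the margin makes some weight at least [3 * tau]; moving by [h] loses at most
   [tau / 4]. *)
have core : ~ K None y -> exists2 j, K (Some j) y & 2 * tau <= q j y.
  move=> /(near_boundary Uy)[p bp py]; have [j pj] := margin bp.
  have qy : q j p - tau / 4 <= q j y.
    apply: q_move; last by rewrite enormBC ltW.
    by apply/ltW/sqr_lt; slra.
  have q2 : 2 * tau <= q j y by move: qy; rewrite /q; slra.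
  by exists j => //; split => //=; slra.
case: i Diy nKy => [j|] Diy nKy.
  have [_ qj] := Diy; have [_ /ler_normlP[_ Fj]] := zF j qj.
  have qj2 : q j y < tau / 2 by rewrite ltNge; apply/negP => ?; apply: nKy; split; case: Diy.
  have Aq : A * q j y <= A * (tau / 2) by rewrite ler_wpM2l// ltW.
  have [K0|/core[i Ki qi]] := pselect (K None y).
    exists None => //; rewrite /u weightE (mulrDr A (q j y)) (mulrDr A _ tau).
    by move: Fj; rewrite (zO K0.1) => Fj; lra.
  exists (Some i) => //; rewrite /u !weightE (mulrDr A (q j y)) (mulrDr A (q i y)).
  have [|_ /ler_normlP[Fi _]] := zF i; first by slra.
  have : A * (2 * tau) <= A * q i y by rewrite ler_wpM2l.
  by lra.
have [i Ki qi] := core nKy; exists (Some i) => //; rewrite /u weightE (mulrDr A (q i y)) (mulrDr A _ tau).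
have [|_ /ler_normlP[Fi _]] := zF i; first by slra.
rewrite (zO Diy) in Fi.
have : A * (2 * tau) <= A * q i y by rewrite ler_wpM2l.
by lra.
Qed.

Lemma approximation (S M : R) : Omega !=set0 ->
  (forall j, s j <= S) -> (forall z, closure Omega z -> enorm z <= M) ->
  exists psi : 'rV[R]_(n + n) -> \bar R,
    [/\ plurisubharmonic (fattening Omega mu) psi,
        continuous_on (fattening Omega mu) psi &
        forall z, closure Omega z ->
          (`|psi z - phi z| <= ((2 + 8 / tau * (tau + S ^+ 2 + M ^+ 2)) * l)%:E)%E].
Proof.
move=> O0 sS zM; have l0 := l_ge0 O0.
have A0 : 0 <= A by rewrite /A divr_ge0 ?mulr_ge0// ltW.
have covered z : U z -> exists i, D i z.
  move=> Uz; have [/KD Dz|/(near_boundary Uz)[p bp pz]] := pselect (K None z).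
    by exists None.
  have [j pj] := margin bp; exists (Some j); split => //=.
  have qy : q j p - tau / 4 <= q j z.
    apply: q_move; last by rewrite enormBC ltW.
    by apply/ltW/sqr_lt; slra.
  by move: qy; rewrite /q; slra.
have [psi psiP] := active_max_exists u covered.
have oU : open U by exact: fattening_open.
have cpsi : forall z, U z -> {for z, continuous psi}.
  exact: (active_max_continuous oU open_D KD near_notK continuous_u dominated psiP).
exists (EFin \o psi); split.
- apply: submean_plurisubharmonic => //.
  apply: locally_submean_submean => // z Uz.
  have [[i Di pz] _] := psiP z Uz.
  (* The active piece attaining the maximum touches [psi] from below. *)
  exists (D i), (u i); split => //.
  + by apply: open_nbhs_nbhs; split => //; exact: open_D.
  + exact: submean_u.
  + by move=> y Diy; exact: continuous_u.
  + move=> y Diy; have Uy : U y by case: i Diy {Di pz} => [j [//]|/OU].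
    by split => //; have [_ ->] := psiP y Uy.
- exact: continuous_on_EFin.
- move=> z cz; have [_ phiE] := continuous_on_fine cphi.
  rewrite (phiE z cz) /= lee_fin -/(F z).
  have [[i Di pz] _] := psiP z (cOU cz); rewrite pz.
  have [b ub bE] := closure_bound cz Di.
  (* This bounds the error by [2 * l + A * b] with [A] proportional to [l], whence a constant
     multiple of [l]. *)
  have b0 : 0 <= b <= tau + S ^+ 2 + M ^+ 2.
    have zz : enorm z ^+ 2 <= M ^+ 2.
      rewrite ler_sqr ?nnegrE ?enorm_ge0 ?zM//.
      exact: le_trans (enorm_ge0 z) (zM z cz).
    have S0 := sqr_ge0 S; have z0 := sqr_ge0 (enorm z).
    rewrite bE; case: i Di {pz ub bE} => [j [_ /= qj]|_]; apply/andP; split; try slra.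
    have /andP[sj _] := s_itv j.
    have : s j ^+ 2 <= S ^+ 2.
      by rewrite ler_sqr ?nnegrE ?sS ?(ltW sj)// (le_trans (ltW sj)).
    by have := sqr_ge0 (enorm (z - x j)); rewrite /q; slra.
  have /andP[b1 b2] := b0.
  have Ab : 0 <= A * b by rewrite mulr_ge0.
  have AM : A * b <= A * (tau + S ^+ 2 + M ^+ 2) by rewrite ler_wpM2l.
  have AE : 8 / tau * (tau + S ^+ 2 + M ^+ 2) * l = A * (tau + S ^+ 2 + M ^+ 2).
    by rewrite /A; ring.
  rewrite mulrDl AE; move: ub => /ler_normlP[ub1 ub2].
  by apply/ler_normlP; split; lra.
Qed.

End Construction.

(** * The theorem *)

(** Without boundary points [Omega] is closed, so [Omega] and [phi] themselves serve, and the
    distance to the empty set is [+oo]. *)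
Lemma boundaryless_approximation (R : realType) (n : nat)
    (Omega : set 'rV[R]_(n + n)) (phi : 'rV[R]_(n + n) -> \bar R) (d C : R) :
  domain Omega -> bounded_set Omega -> boundary Omega = set0 ->
  psh_near (closure Omega) phi -> continuous_on (closure Omega) phi ->
  0 <= C -> forall t : R, 0 <= t ->
  [/\ domain Omega /\ compactly_contained Omega Omega,
      plurisubharmonic Omega phi /\ continuous_on Omega phi,
      forall z, closure Omega z ->
        (`|phi z - phi z| <= C%:E * modulus phi (closure Omega) t)%E &
      (d%:E < set_dist Omega (boundary Omega))%E].
Proof.
move=> [oO cO] bO b0 [V [cOV [_ phi_lt usc mv]]] cphi C0 t t0.
have cE : closure Omega `<=` Omega.
  by move=> z /closure_boundary[//|]; rewrite b0.
have Oc : Omega `<=` closure Omega by exact: subset_closure.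
have OV : Omega `<=` V by move=> z /Oc /cOV.
have [cpt _] := bounded_closure_compact bO.
split.
- by split; split.
- split; first split => //.
  + by move=> z /OV; exact: phi_lt.
  + move=> z a Oz phia; have := usc z a (OV z Oz) phia.
    by apply: filterS => y H /OV; exact: H.
  + by move=> a b dO; apply: mv => tau /dO /OV.
  + case: cphi => fin cont; split => [z /Oc|]; first exact: fin.
    exact: continuous_subspaceW Oc cont.
- move=> z cz.
  have zA : closure Omega !=set0 by exists z.
  have [l -> lP] := modulus_fin cpt zA cphi t0.
  have l0 : 0 <= l by apply: le_trans (lP z z cz cz _); rewrite // subrr enorm0.
  have [_ /(_ z cz) ->] := continuous_on_fine cphi.
  by rewrite -EFinB subrr abse0 -EFinM lee_fin mulr_ge0.
- rewrite (_ : set_dist _ _ = +oo%E) ?ltry// /set_dist.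
  rewrite (_ : [set _ | _] = set0) ?ereal_inf0//.
  by rewrite -subset0 b0 => e [z [y []]].
Qed.

(** The square grows by at most [2 * h * S + h ^+ 2], and [h ^+ 2 <= h]. *)
Lemma square_shift (R : realType) (m : nat) (x v v' : 'rV[R]_m) (S h e : R) :
  0 <= h -> h <= 1 -> h * (2 * S + 1) <= e ->
  enorm (v - x) <= S -> enorm (v' - v) <= h ->
  enorm (v' - x) ^+ 2 <= enorm (v - x) ^+ 2 + e.
Proof.
move=> h0 h1 hS vx vh.
have a0 := enorm_ge0 (v - x).
have le : enorm (v' - x) <= enorm (v - x) + h.
  by rewrite (le_trans (ler_enorm_dist v _ _))// [leLHS]addrC lerD.
apply: (@le_trans _ _ ((enorm (v - x) + h) ^+ 2)).
  by rewrite ler_sqr ?nnegrE ?enorm_ge0// addr_ge0.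
have : h * enorm (v - x) <= h * S by rewrite ler_wpM2l.
have : h * h <= h * 1 by rewrite ler_wpM2l.
by rewrite sqrrD; lra.
Qed.

Theorem corollary2 (R : realType) (n : nat) (Hn : (0 < n)%N)
    (Omega : set 'rV[R]_(n + n))
    (k : nat) (x : 'I_k -> 'rV[R]_(n + n)) (r : 'I_k -> R)
    (w : 'I_k -> 'rV[R]_(n + n))
    (Hdom : domain Omega) (Hbdd : bounded_set Omega)
    (HC0 : C0_boundary Omega x r w)
    (c : R) (Hc : 1 <= c)
    (Hcov : covers_neighbourhood (boundary Omega) x (fun j => r j / c)) :
  exists2 C : R, 1 < C &
  forall eps1 : R, 0 < eps1 -> eps1 < 1 ->
  exists2 eps0 : R, 0 < eps0 <= eps1 &
  forall f : R -> R,
    (forall (j : 'I_k) (z : 'rV[R]_(n + n)) (eps : R),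
       Omega z -> eball (x j) (r j / c) z -> 0 < eps -> eps < eps1 ->
       (set_dist [set z] (boundary Omega) + (f eps)%:E
          <= set_dist [set (z + eps *: w j)%R] (boundary Omega))%E) ->
  forall (phi : 'rV[R]_(n + n) -> \bar R) (eps : R),
    psh_near (closure Omega) phi -> continuous_on (closure Omega) phi ->
    0 < eps -> eps < eps0 ->
  exists (U : set 'rV[R]_(n + n)) (psi : 'rV[R]_(n + n) -> \bar R),
    [/\ domain U /\ compactly_contained Omega U,
        plurisubharmonic U psi /\ continuous_on U psi,
        forall z, closure Omega z ->
          (`|psi z - phi z| <= C%:E * modulus phi (closure Omega) eps)%E &
        ((f eps)%:E < set_dist Omega (boundary U))%E].
Proof.
have [oO cO] := Hdom.
have [b0|/set0P[p0 bp0]] := eqVneq (boundary Omega) set0.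
  exists 2 => [|eps1 eps1_gt0 _]; first by rewrite ltr1n.
  exists eps1; first by rewrite eps1_gt0 lexx.
  move=> f _ phi eps pphi cphi eps_gt0 _; exists Omega, phi.
  exact: (boundaryless_approximation _ Hdom Hbdd b0 pphi cphi _ (ltW eps_gt0)).
have bn0 : boundary Omega !=set0 by exists p0.
have O0 : Omega !=set0.
  by have [cp0 _] := bp0; have [y [Oy _]] := cp0 _ filterT; exists y.
have [cptO [M M0 MO]] := bounded_closure_compact Hbdd.
have cptb : compact (boundary Omega).
  by apply: (subclosed_compact (@boundary_closed _ Omega) cptO) => z [].
have [rpos _ _] := HC0.
pose s j := r j / c.
have c0 : 0 < c by apply: lt_le_trans Hc.
have s_itv j : 0 < s j <= r j.
  have [_ rj] := rpos j; rewrite divr_gt0//= ler_pdivrMr//.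
  by rewrite ler_peMr// ltW.
(* The cover by the shrunken balls of radius [r j / c] gives a positive margin at each boundary
   point. *)
have [tau4 tau40 margin4] : exists2 tau, 0 < tau & forall p, boundary Omega p ->
    exists i, tau <= s i ^+ 2 - enorm (p - x i) ^+ 2.
  apply: compact_cover_margin => // [i|p bp]; first exact: continuous_sqr_dist.
  have [N [_ bN NB]] := Hcov; have [j pj] := NB _ (bN _ bp).
  exists j; rewrite subr_gt0 ltr_pXn2r ?nnegrE ?enorm_ge0//.
  by have /andP[/ltW] := s_itv j.
pose tau := tau4 / 4.
have tau0 : 0 < tau by rewrite divr_gt0.
have margin p : boundary Omega p ->
    exists i, 4 * tau <= s i ^+ 2 - enorm (p - x i) ^+ 2.
  by move=> bp; have [i ti] := margin4 p bp; exists i; rewrite /tau mulrC divfK.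
pose S := \sum_j s j.
have sS j : s j <= S.
  rewrite /S (bigD1 j)//= lerDl sumr_ge0// => i _.
  by have /andP[/ltW] := s_itv i.
have S0 : 0 <= S by apply: sumr_ge0 => i _; have /andP[/ltW] := s_itv i.
have [h h0 [h1 hS hr]] : exists2 h, 0 < h &
    [/\ h <= 1, h * (2 * S + 1) <= tau / 4 & forall j, h <= r j].
  have S1 : 0 < 2 * S + 1 by lra.
  pose h0 := Num.min 1 (tau / 4 / (2 * S + 1)).
  exists (\big[Num.min/h0]_j r j).
    apply: lt_bigmin => [|j _]; last by have [] := rpos j.
    by rewrite lt_min ltr01 !divr_gt0.
  have le0 : \big[Num.min/h0]_j r j <= h0 by exact: bigmin_le_id.
  split.
  - by apply: (le_trans le0); rewrite ge_min lexx.
  - by rewrite -ler_pdivlMr//; apply: (le_trans le0); rewrite ge_min lexx orbT.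
  - by move=> j; exact: bigmin_le_cond.
have shift j v v' : enorm (v - x j) <= s j -> enorm (v' - v) <= h ->
    enorm (v' - x j) ^+ 2 <= enorm (v - x j) ^+ 2 + tau / 4.
  move=> vs; apply: (square_shift (ltW h0) h1 hS).
  exact: le_trans vs (sS j).
(* [tau], [S] and [M] are fixed before [eps1], so [C] depends only on [Omega], its balls and [c]. *)
pose C := 2 + 8 / tau * (tau + S ^+ 2 + M ^+ 2).
have C2 : 2 <= C.
  rewrite /C lerDl mulr_ge0// ?addr_ge0 ?sqr_ge0 ?(ltW tau0)//.
  by rewrite divr_ge0 ?(ltW tau0).
exists C; first by lra.
move=> eps1 eps1_gt0 eps1_lt1; exists (Num.min eps1 (h / 2)).
  by rewrite lt_min eps1_gt0 divr_gt0//= ge_min lexx.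
move=> f Hf phi eps pphi cphi eps_gt0; rewrite lt_min => /andP[eps_lt1 eps_h].
have eps_h2 : 2 * eps <= h by lra.
(* The hypothesis is applied at [p + eps *: w j], which [shift] keeps in the shrunken ball. *)
have steps j p : boundary Omega p -> enorm (p - x j) ^+ 2 <= s j ^+ 2 - tau / 2 ->
    [/\ Omega (p + eps *: w j), Omega (p + (2 * eps) *: w j) &
      edist (p + eps *: w j) (boundary Omega) + f eps <=
      edist (p + (2 * eps) *: w j) (boundary Omega)].
  move=> bp ps; have /andP[s0 sr] := s_itv j.
  have lt_s v : enorm (v - x j) ^+ 2 < s j ^+ 2 -> enorm (v - x j) < s j.
    by rewrite ltr_pXn2r// nnegrE ?enorm_ge0// ltW.
  have pss : enorm (p - x j) < s j by apply: lt_s; lra.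
  have pr : enorm (p - x j) < r j by apply: lt_le_trans sr.
  have e1 : eps <= r j by have := hr j; lra.
  have e2 : 2 * eps <= r j by have := hr j; lra.
  have e20 : 0 < 2 * eps by lra.
  have cp : closure Omega p by case: bp.
  have O1 : Omega (p + eps *: w j) by exact: (inward_step HC0).
  split => //; first exact: (inward_step HC0).
  have near_x : eball (x j) (r j / c) (p + eps *: w j).
    apply: lt_s; apply: le_lt_trans (shift j p _ (ltW pss) _) _; last by lra.
    by rewrite addrC addKr (enorm_step HC0) ?(ltW eps_gt0)//; lra.
  have := Hf j _ eps O1 near_x eps_gt0 eps_lt1.
  rewrite !set_dist1E// -EFinD lee_fin.
  by rewrite mulr2n mulrDl mul1r scalerDl addrA.
(* The distance to the boundary is 1-Lipschitz, so a step of length [eps] gains at most [eps]; this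
   leaves room for [mu] below [2 * eps]. *)
have feps : f eps < 2 * eps.
  have [i pi_] := margin _ bp0.
  have [|z1 z2 d12] := steps i p0 bp0; first by lra.
  have := edist_lipschitz (p0 + (2 * eps) *: w i) (p0 + eps *: w i) bn0.
  rewrite opprD addrACA subrr add0r -scalerBl mulr2n mulrDl mul1r addrK.
  rewrite (enorm_step HC0) ?(ltW eps_gt0)// => le_eps; move: d12.
  by rewrite mulr2n mulrDl mul1r; lra.
(* The maximum with 0 keeps [mu] positive even if [f eps] is negative. *)
have [mu /andP[mu_gt mu_le] muP] : exists2 mu, Num.max (f eps) 0 < mu <= 2 * eps &
    forall j p, (boundary Omega `&`
       [set p | enorm (p - x j) ^+ 2 <= s j ^+ 2 - tau / 2]) p ->
    mu <= edist (p + (2 * eps) *: w j) (boundary Omega).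
  apply: (@compact_uniform_lower_bound _ _ _
    (fun j => boundary Omega `&`
      [set p | enorm (p - x j) ^+ 2 <= s j ^+ 2 - tau / 2])
    (fun j (p : 'rV[R]_(n + n)) => edist (p + (2 * eps) *: w j) (boundary Omega))).
  - move=> j; apply: (subclosed_compact _ cptb) => [|z []//].
    apply: closedI; first exact: boundary_closed.
    rewrite (_ : [set p | _] = [set p | tau / 2 <= s j ^+ 2 - enorm (p - x j) ^+ 2]).
      apply: (preimage_closed
        (f := fun p : 'rV[R]_(n + n) => s j ^+ 2 - enorm (p - x j) ^+ 2)
        (D := [set t : R | tau / 2 <= t])).
      + by move=> z _; exact: continuous_sqr_dist.
      + exact: closed_ge.
    by apply/seteqP; split => z /=; lra.
  - move=> j z; apply: (@continuous_comp _ _ _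
      (fun p : 'rV[R]_(n + n) => p + (2 * eps) *: w j)
      (fun p => edist p (boundary Omega))).
      by apply: (@cvgD _ _ _ (nbhs z)); [exact: cvg_id|exact: cvg_cst].
    exact: continuous_edist.
  - by rewrite gt_max feps; lra.
  (* Strictness comes from the point [p + eps *: w j] of the open set [Omega], whose distance to the
     boundary is positive. *)
  - move=> j p [bp /= ps]; have [z1 z2 d12] := steps j p bp ps.
    have pos v : Omega v -> 0 < edist v (boundary Omega).
      move=> Ov; apply: edist_gt0 => //; first exact: boundary_closed.
      by move=> /(boundary_not_open oO).
    rewrite gt_max pos// andbT; apply: lt_le_trans d12.
    by rewrite ltrDr pos.
have /andP[f_mu mu0] : (f eps < mu) && (0 < mu) by rewrite -gt_max.
have mu_in j p : boundary Omega p ->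
    enorm (p - x j) ^+ 2 <= s j ^+ 2 - tau / 2 ->
    eball (p + (2 * eps) *: w j) mu `<=` Omega.
  move=> bp ps; have [_ O2 _] := steps j p bp ps.
  by apply: eball_edist => //; exact: muP.
have cO0 : closure Omega !=set0 by case: O0 => z Oz; exists z; exact: subset_closure.
have [l lE l_mod] := modulus_fin cptO cO0 cphi (ltW eps_gt0).
have [psi [ppsi cpsi psiP]] := approximation oO HC0 s_itv tau0 margin hr shift
  eps_gt0 eps_h2 mu0 mu_le mu_in pphi cphi l_mod O0 sS MO.
exists (fattening Omega mu), psi; split => //.
- split; first by split; [exact: fattening_open|exact: fattening_connected].
  by split => //; exact: closure_fattening.
- by rewrite lE.
- by apply: lt_le_trans (fattening_dist Omega mu); rewrite lte_fin.
Qed.
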